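(* Let $k$ be a number field and let $d$ be a positive integer. Let $k^{[d]} = k(\beta \in \overline{k} : [k(\beta):k] = d)$, where $\overline{k}$ is a fixed algebraic closure of $k$. Then $k^{[d]}$ is bounded over $k$ if and only if $d \leq 2$.
   Context: An algebraic extension $M$ of $k$ (inside $\overline{k}$) is called bounded over $k$ if there is a constant $c$ such that every finite subextension $K/k$ with $k \subseteq K \subseteq M$ is generated over $k$ by elements of degree at most $c$ over $k$; otherwise $M/k$ is unbounded. *)

(* Defs.v *)
From HB Require Import structures.
From mathcomp Require Import all_boot all_order all_algebra all_field.
From mathcomp Require Import boolp classical_sets.

Set Implicit Arguments.
Unset Strict Implicit.
Unset Printing Implicit Defensive.

Import GRing.Theory.

Local Open Scope classical_set_scope.
Local Open Scope ring_scope.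

(* An algebraic closure of k is infinite-dimensional over k, so its
   intermediate fields are not {subfield _}: they are sets closed under the
   field operations and containing the image of iota : k -> L. *)
Definition intermediate_field (k L : fieldType) (iota : {rmorphism k -> L})
    (M : set L) : Prop :=
  GRing.divring_closed (mem M) /\ range iota `<=` M.

(* L is an algebraically closed field by its type. *)
Definition is_algebraic_closure (k : fieldType) (L : closedFieldType)
    (iota : {rmorphism k -> L}) : Prop :=
  forall x : L, algebraicOver iota x.

(* k(S) *)
Definition adjoin (k L : fieldType) (iota : {rmorphism k -> L}) (S : set L) :
    set L :=
  smallest (intermediate_field iota) S.

(* [M : k] = n: M has a k-basis with n elements, where k acts through iota. *)
Definition has_degree (k L : fieldType) (iota : {rmorphism k -> L})
    (M : set L) (n : nat) : Prop :=
  exists b : 'I_n -> L,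
    (forall i, M (b i)) /\
    (forall x, M x ->
       exists! c : 'rV[k]_n, x = \sum_(i < n) iota (c ord0 i) * b i).

Definition finite_over (k L : fieldType) (iota : {rmorphism k -> L})
    (M : set L) : Prop :=
  exists n : nat, has_degree iota M n.

Definition elt_degree (k L : fieldType) (iota : {rmorphism k -> L})
    (x : L) (n : nat) : Prop :=
  has_degree iota (adjoin iota [set x]) n.

Definition bounded_over (k L : fieldType) (iota : {rmorphism k -> L})
    (M : set L) : Prop :=
  exists c : nat, forall K : set L,
    intermediate_field iota K -> K `<=` M -> finite_over iota K ->
    exists S : set L,
      (forall x, S x -> exists2 n : nat, (n <= c)%N & elt_degree iota x n) /\
      K = adjoin iota S.

(* k^[d] *)
Definition compositum_of_degree (k L : fieldType)
    (iota : {rmorphism k -> L}) (d : nat) : set L :=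
  adjoin iota [set x | elt_degree iota x d].

(* Main.v *)
Require Import Defs.
From HB Require Import structures.
From mathcomp Require Import all_boot all_order all_algebra all_field.
From mathcomp Require Import boolp classical_sets.
From mathcomp Require Import ring zify.
From mathcomp Require cyclic.

(* For d <= 2, every element of k^[d] is a finite sum of square roots of
   elements of k, and if such a sum lies in an intermediate field K, then so
   does the sum of those of its terms that lie in K, while the other terms
   cancel; so K is generated by square roots.

   For d >= 3, let z be a primitive d-th root of unity.  Choose t_0, ..., t_(c+1)
   rational and w_r with w_r^d + w_r^-d = t_r such that the maps
   w_r |-> z^(j_r) w_r^(+-1) are realised by embeddings for all independent
   choices of exponents and signs.  The elements z^j w_r + (z^j w_r)^-1 have
   degree d, and k^[d] contains D = G + 1/G, where G is the product of the w_r.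
   Let x = P(D) have degree at most c.  Among the c + 1 conjugates of x obtained
   by inverting w_s for one s > 0, two agree, say for r and s.  Applying
   w_0 |-> z w_0, w_r |-> z w_r, w_s |-> 1/w_s to this equality, and also
   w_s |-> 1/w_s alone, gives P(z^2 G + 1/(z^2 G)) = P(G + 1/G).  So all elements
   of k(D) of degree at most c are fixed by w_0 |-> z^2 w_0, which moves D.

   The t_r come from degree one places.  Over a number field E containing z,
   choose a prime a that is not a square in E, and a prime l with a place of
   degree one of E(sqrt a) above it, unramified over l.  A suitable
   alpha = (r + sqrt a)/(r - sqrt a) has valuation 1 there, so X^d - alpha is
   irreducible over E(sqrt a), and X^2d - tX^d + 1 is irreducible over E for
   t = alpha + 1/alpha. *)

Set Implicit Arguments.
Unset Strict Implicit.
Unset Printing Implicit Defensive.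

Import Order.TTheory GRing.Theory Num.Theory.

Local Open Scope ring_scope.

(** * Number fields and places of degree one *)

(** The extension is E[X]/(f), with [g] the class of X: a polynomial vanishing at [g] is a multiple
    of f, so evaluation at any root [w] factors through it. Conjugates can then be prescribed
    without Galois groups. *)
Lemma root_extension (E : fieldExtType rat) (f : {poly E}) :
  irreducible_poly f ->
  exists (L : fieldExtType rat) (inE : {rmorphism E -> L}) (g : L),
    root (map_poly inE f) g /\
    forall (K : fieldType) (e : {rmorphism E -> K}) (w : K),
      root (map_poly e f) w ->
      exists e' : {rmorphism L -> K}, (forall x, e' (inE x) = e x) /\ e' g = w.
Proof.
move=> f_irr; have [L _ [g rg genL]] := irredp_FAdjoin f_irr.
exists (baseFieldType L); exists (in_alg L : {rmorphism E -> L}); exists g.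
split=> // K e w rw.
have evP (P : {poly E}) : (map_poly (in_alg L) P).[g] = 0 -> (map_poly e P).[w] = 0.
  move=> Pg; have : f %| P.
    apply: contraT => nfP.
    have : coprimep f P by rewrite irreducible_poly_coprime.
    rewrite -(coprimep_map (in_alg L)) => /coprimep_root-/(_ _ rg).
    by rewrite Pg eqxx.
  by case/dvdpP=> Q ->; rewrite rmorphM hornerM (rootP rw) mulr0.
have polyX (x : L) : exists P : {poly E}, x = (map_poly (in_alg L) P).[g].
  by apply/Fadjoin1_polyP; rewrite genL memvf.
pose pol (x : L) := projT1 (cid (polyX x)).
have polE x : (map_poly (in_alg L) (pol x)).[g] = x.
  by rewrite -(projT2 (cid (polyX x))).
(* The representing polynomial is an arbitrary choice; [evP] makes the value independent of it. *)
pose h (x : L) := (map_poly e (pol x)).[w].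
have hE (P : {poly E}) : h (map_poly (in_alg L) P).[g] = (map_poly e P).[w].
  apply/eqP; rewrite -subr_eq0 -hornerN -hornerD -rmorphB.
  by apply/eqP/evP; rewrite rmorphB hornerD hornerN polE subrr.
have hB : zmod_morphism h.
  by move=> x y; rewrite -[x]polE -[y]polE -hornerN -hornerD -rmorphB !hE rmorphB hornerD hornerN.
have hM : monoid_morphism h.
  split; last first.
    by move=> x y; rewrite -[x]polE -[y]polE -hornerM -rmorphM !hE rmorphM hornerM.
  have -> : 1 = (map_poly (in_alg L) 1).[g] by rewrite rmorph1 hornerC.
  by rewrite hE rmorph1 hornerC.
exists (HB.pack_for {rmorphism (baseFieldType L) -> K} h 
  (GRing.isZmodMorphism.Build _ _ h hB) (GRing.isMonoidMorphism.Build _ _ h hM)).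
split=> /= [x|].
  by have := hE x%:P; rewrite !map_polyC !hornerC /=.
by have := hE 'X; rewrite !map_polyX !hornerX.
Qed.

Lemma fieldExt_intr_eq0 (E : fieldExtType rat) (a : int) : (a%:~R == 0 :> E) = (a == 0).
Proof. by rewrite -(rmorph_int (in_alg E)) fmorph_eq0 intr_eq0. Qed.

Lemma fieldExt_natr_eq0 (E : fieldExtType rat) (a : nat) : (a%:R == 0 :> E) = (a == 0)%N.
Proof. exact: (fieldExt_intr_eq0 E a). Qed.

Lemma exists_nonroot_int (p : {poly int}) : p != 0 -> exists y : int, ~~ root p y.
Proof.
move=> p0; apply: contrapT => /forallNP nr.
pose s := [seq i%:Z | i <- iota 0 (size p)].
have : (size s < size p)%N.
  apply: max_poly_roots => //; last by rewrite map_inj_uniq ?iota_uniq // => i j [].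
  by apply/allP => y _; apply: contrapT => ny; apply: (nr y); apply/negP.
by rewrite size_map size_iota ltnn.
Qed.

(* With c = g(0) nonzero, g(c D y) / c is 1 modulo D. *)
Lemma prime_dividing_value (g : {poly int}) (D : nat) :
  (1 < size g)%N -> (0 < D)%N ->
  exists (l : nat) (n : int), [/\ prime l, ~~ (l %| D)%N & (l %| g.[n])%Z].
Proof.
move=> sg D0; have [g0|g0] := eqVneq g.[0] 0.
  have [l lD pl] := prime_above D; exists l, 0; split=> //; last by rewrite g0 dvdz0.
  by apply: contraL lD => /(dvdn_leq D0); rewrite -leqNgt.
set c := g.[0] in g0.
have /factor_theorem [g1] : root (g - c%:P) 0 by rewrite rootE !hornerE subrr.
rewrite subr0 => Eg.
pose H := 1 + D%:Z%:P * 'X * (g1 \Po (c * D%:Z *: 'X)) : {poly int}.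
have HE y : H.[y] = 1 + D%:Z * (y * (g1 \Po (c * D%:Z *: 'X)).[y]).
  by rewrite /H hornerD !hornerM !hornerC hornerX -mulrA.
have sg1 : g1 != 0.
  apply: contraTneq sg => g10; move: Eg; rewrite g10 mul0r => /eqP.
  by rewrite subr_eq0 => /eqP ->; rewrite -leqNgt size_polyC leq_b1.
have DZ : D%:Z != 0 by rewrite -lt0n.
have sH : (1 < size (H - 1)%R)%N.
  rewrite /H addrC addKr mulrAC size_mulX ?ltnS ?lt0n ?size_poly_eq0.
    rewrite mulf_neq0 ?polyC_eq0 // -size_poly_eq0 size_comp_poly2 ?size_poly_eq0 //.
    by rewrite size_scale ?size_polyX // mulf_neq0.
  rewrite mulf_neq0 ?polyC_eq0 // -size_poly_eq0 size_comp_poly2 ?size_poly_eq0 //.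
  by rewrite size_scale ?size_polyX // mulf_neq0.
have H2 a : H - a%:P != 0.
  apply: contraTneq sH => /eqP; rewrite subr_eq0 => /eqP ->.
  by rewrite -leqNgt -polyC1 -polyCB size_polyC leq_b1.
move: (H) H2 HE => {sH}H' H2 HE.
(* A value other than 0, 1 and -1 has a prime divisor, and that prime cannot divide D because the
   value is 1 modulo D. *)
have [y] : exists y, ~~ root ((H' - 0%:P) * (H' - 1%:P) * (H' - (-1)%:P)) y.
  by apply: exists_nonroot_int; rewrite !mulf_neq0 ?H2.
rewrite !rootM !negb_or !rootE !hornerE !subr_eq0 ?subr0 => /andP [/andP[h0 h1] hN1].
have h2 : (1 < `|H'.[y]|)%N by move: (H'.[y]) h0 h1 hN1 => [[|[]]|[|]].
exists (pdiv `|H'.[y]|), (c * D%:Z * y); split; first exact: pdiv_prime.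
  apply: contraTN (pdiv_prime h2) => lD.
  have : (pdiv `|H'.[y]| %| 1%N)%N.
    rewrite -[X in (X %| _)%N]/(`|(pdiv `|H'.[y]|)%:Z|)%N -[1%N]/`|1%:Z|%N -dvdzE.
    have -> : 1%:Z = H'.[y] - D%:Z * (y * (g1 \Po (c * D%:Z *: 'X)).[y]).
      by rewrite HE addrK.
    by rewrite rpredB ?dvdz_mulr // dvdzE /= ?pdiv_dvd.
  by rewrite dvdn1 => /eqP ->.
have -> : g.[c * D%:Z * y] = c * H'.[y].
  have := congr1 (fun q => q.[c * D%:Z * y]) Eg; rewrite !hornerE => /eqP.
  rewrite subr_eq => /eqP ->.
  rewrite HE horner_comp hornerZ hornerX /=; ring.
by rewrite dvdz_mull // dvdzE /= pdiv_dvd.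
Qed.

Lemma primitive_element_char0 (E : fieldExtType rat) : exists xi : E, <<1; xi>>%VS = fullv.
Proof.
exists (separable_generator 1 {:E}); symmetry.
apply: eq_adjoin_separable_generator; last exact: subvf.
apply/separableP => y _; apply: pcharf0_separable.
by apply/pcharf0P => n; rewrite fieldExt_natr_eq0.
Qed.

(** [g] is the primitive part of an integral multiple of the minimal polynomial of [xi]. Primitivity
    lets divisibility descend from Q to Z by Gauss's lemma. Separability, with denominators cleared
    in the Bezout relation, puts a nonzero integer R in the ideal (g, g'). *)
Lemma int_primitive_element (E : fieldExtType rat) :
  exists (xi : E) (g : {poly int}),
    [/\ forall P : {poly int}, (map_poly intr P).[xi] = 0 -> exists W, P = g * W,
        (map_poly intr g).[xi] = 0,
        (1 < size g)%N,
        exists2 R : int, R != 0 & exists A B, R%:P = A * g + B * g^`() &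
        forall x : E, exists (P : {poly int}), exists2 c : int, c != 0 &
           x * c%:~R = (map_poly intr P).[xi]].
Proof.
have [xi genE] := primitive_element_char0 E; exists xi.
have [p Dp] : exists p, minPoly 1 xi = map_poly (in_alg E) p.
  by apply/polyOver1P; apply: minPolyOver.
have [q [a a0 Dq]] := rat_poly_scale p.
have evQ (P : {poly int}) : map_poly (in_alg E) (map_poly intr P) = map_poly intr P.
  by rewrite -map_poly_comp; apply: eq_map_poly => z /=; rewrite -(rmorph_int (in_alg E)).
have qp : map_poly intr q %= p by rewrite Dq eqp_sym eqp_scale // invr_eq0 intr_eq0.
have q0 : q != 0.
  apply: contraTneq (monic_neq0 (monic_minPoly 1 xi)) => q0.
  by rewrite Dp Dq q0 !(rmorph0, scaler0) eqxx.
have gp : map_poly intr (zprimitive q) %= p.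
  apply: eqp_trans qp; rewrite [X in _ %= map_poly _ X](zpolyEprim q) map_polyZ /=.
  by rewrite eqp_sym eqp_scale // intr_eq0 zcontents_eq0.
exists (zprimitive q); split.
- move=> P Pxi; have : minPoly 1 xi %| map_poly intr P.
    apply: minPoly_dvdp; last exact/rootP.
    by rewrite -evQ; apply: alg_polyOver.
  rewrite Dp -evQ dvdp_map -(eqp_dvdl _ qp) dvdp_rat_int.
  by case/dvdpP_int => W ->; exists W.
- apply/rootP; rewrite -evQ.
  have -> : root (map_poly (in_alg E) (map_poly intr (zprimitive q))) xi = root (minPoly 1 xi) xi.
    by rewrite Dp; apply: eqp_root; rewrite eqp_map.
  exact: root_minPoly.
- rewrite -size_rat_int_poly (eqp_size gp) -(size_map_poly (in_alg E)) -Dp size_minPoly.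
  by [].
- have : separable_poly (map_poly (intr : int -> rat) (zprimitive q)).
    rewrite (eqp_separable gp) -(separable_map (in_alg E)) -Dp.
    by apply: pcharf0_separable; apply/pcharf0P => n; rewrite fieldExt_natr_eq0.
  rewrite separable_poly.unlock => /Bezout_eq1_coprimepP [[u v] /= uv].
  have [A [c c0 Du]] := rat_poly_scale u; have [B [c' c'0 Dv]] := rat_poly_scale v.
  exists (c * c'); first by rewrite mulf_neq0.
  exists (c' *: A), (c *: B); apply: (map_inj_poly (intr_inj : injective (intr : int -> rat))) => //.
  rewrite map_polyC /= rmorphD !rmorphM /= !map_polyZ /= -deriv_map.
  have cV (z : int) : z != 0 -> (z%:~R : rat)%:P * (z%:~R^-1)%:P = 1 :> {poly rat}.
    by move=> z0; rewrite -polyCM mulfV ?intr_eq0.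
  rewrite -[LHS]mulr1 -uv Du Dv -!mul_polyC.
  set G := map_poly _ (zprimitive q); set a' := map_poly _ A; set b' := map_poly _ B.
  transitivity ((c%:~R%:P * (c%:~R^-1)%:P) * (c'%:~R%:P * a' * G)
    + (c'%:~R%:P * (c'%:~R^-1)%:P) * (c%:~R%:P * b' * G^`())); first by ring.
  by rewrite !cV // !mul1r.
- move=> x; have /Fadjoin1_polyP [P ->] : x \in <<1; xi>>%VS by rewrite genE memvf.
  have [P' [c c0 ->]] := rat_poly_scale P; exists P', c => //.
  rewrite map_polyZ hornerZ evQ mulrAC -(rmorph_int (in_alg E)) -rmorphM.
  by rewrite mulVf ?intr_eq0 // rmorph1 mul1r.
Qed.

(* V x z means that x has valuation z, for a place of E over l that is unramified
   and has residue field F_l; nothing is required of V 0. *)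
Record place (E : fieldExtType rat) (l : nat) (V : E -> int -> Prop) : Prop :=
  Place {
    place_prime : prime l;
    place_total : forall x, x != 0 -> exists z, V x z;
    place_fun : forall x z z', V x z -> V x z' -> z = z';
    place_mul : forall x y z z', V x z -> V y z' -> V (x * y) (z + z');
    place_uniformizer : V l%:R 1;
    place_unit : forall a : int, ~~ (l %| a)%Z -> V a%:~R 0;
    place_sqrt : forall (s : E) (a : int), s ^+ 2 = a%:~R ->
      ~~ (l %| 2 * a)%Z -> exists r : int, V (r%:~R + s) 1 /\ V (r%:~R - s) 0
  }.

(* Let xi be a primitive element, g its primitive integer annihilator and n a root of g
   modulo l.  The place is that of the local ring of Z[xi] at the prime (l, xi - n):
   as g'(n) is prime to l, the equation g(xi) = 0 shows that l generates its
   maximal ideal.  An element has valuation z when it is l^z P(xi) / B(xi) with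
   P(n) and B(n) prime to l. *)
Theorem exists_place (E : fieldExtType rat) (N : nat) : (0 < N)%N ->
  exists (l : nat) (V : E -> int -> Prop), ~~ (l %| N)%N /\ place l V.
Proof.
move=> N0; have [xi [g [gP gxi sg [R R0 [A0 [B0 Rg]]] genE]]] := int_primitive_element E.
(* As l does not divide R, n is a simple root of g modulo l. *)
have [|l [n [pl lD lgn]]] := @prime_dividing_value g (N * `|R|)%N sg.
  by rewrite muln_gt0 N0 absz_gt0.
move: lD; rewrite Euclid_dvdM // negb_or => /andP[lN lR].
pose ev : {rmorphism {poly int} -> E} := horner_eval xi \o map_poly (intr : int -> E).
have evE P : ev P = (map_poly intr P).[xi] by [].
have evC c : ev c%:P = c%:~R by rewrite evE map_polyC hornerC.
clearbody ev.
have dvdM (a b : int) : (l %| a * b)%Z = (l %| a)%Z || (l %| b)%Z.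
  by rewrite !dvdzE abszM Euclid_dvdM.
pose U (P : {poly int}) := ~~ (l %| P.[n])%Z.
have UM P Q : U P -> U Q -> U (P * Q).
  by rewrite /U hornerM dvdM negb_or => -> ->.
have l0 : l%:R != 0 :> E by rewrite fieldExt_natr_eq0 -lt0n prime_gt0.
have UC (c : int) : ~~ (l %| c)%Z -> U c%:P by rewrite /U hornerC.
have U1 : U 1 by apply: UC; rewrite dvdzE /= dvdn1; case: eqP pl => // ->.
have clA P : ev P = 0 -> (l %| P.[n])%Z.
  by rewrite evE => /gP [W ->]; rewrite hornerM dvdz_mulr.
have U0 P : U P -> ev P != 0 by apply: contraNneq => /clA.
have [C Eg] : exists C, g - g.[n]%:P = C * ('X - n%:P).
  by apply/factor_theorem; rewrite rootE !hornerE subrr.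
have UCn : U C.
  apply/negP => lC; move: lR; rewrite -[l]/`|l%:Z|%N -dvdzE; apply/negP/negPn.
  have -> : R = A0.[n] * g.[n] + B0.[n] * C.[n].
    have -> : C.[n] = g^`().[n].
      have := congr1 (fun p => p^`().[n]) Eg.
      by rewrite derivB derivC subr0 derivM derivXsubC !hornerE subrr mulr0 add0r => <-.
    by have := congr1 (fun p => p.[n]) Rg; rewrite !hornerE.
  by rewrite rpredD ?dvdz_mull.
(* The maximal ideal is generated by l: if g = C (X - n) + b l and P = Q (X - n) + a l, then P C - l
   (a C - b Q) = Q g, which vanishes at [xi], and C(n) = g'(n) is prime to l. *)
have clB P : (l %| P.[n])%Z -> exists B P1, U B /\ ev P * ev B = l%:R * ev P1.
  case/dvdzP => a Pn; case/dvdzP: lgn => b gn.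
  have [Q EP] : exists Q, P - P.[n]%:P = Q * ('X - n%:P).
    by apply/factor_theorem; rewrite rootE !hornerE subrr.
  exists C, (a%:P * C - b%:P * Q); split=> //.
  have -> : l%:R = ev (l%:Z)%:P by rewrite evC.
  apply/eqP; rewrite -!rmorphM -subr_eq0 -rmorphB.
  have -> : P * C - l%:Z%:P * (a%:P * C - b%:P * Q) = Q * g.
    have -> : P = Q * ('X - n%:P) + a%:P * l%:Z%:P by rewrite -EP Pn polyCM subrK.
    have -> : g = C * ('X - n%:P) + b%:P * l%:Z%:P by rewrite -Eg gn polyCM subrK.
    ring.
  by rewrite rmorphM (evE g) gxi mulr0.
have clD s c B W : U B -> c%:~R * ev B = l%:R ^+ s * ev W -> ((l ^ s)%N %| c)%Z.
  move=> UB; elim: s c W => [|s IH] c W; first by rewrite expn0 dvd1z.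
  rewrite exprS -mulrA => Ec.
  have : (l %| c)%Z.
    have : (l %| (c%:P * B - l%:Z%:P * (l%:Z%:P ^+ s * W)).[n])%Z.
      by apply: clA; rewrite rmorphB !rmorphM /= rmorphXn /= !evC Ec subrr.
    rewrite hornerD hornerN !hornerM !hornerC rpredBr ?(dvdz_mulr _ (dvdzz l)) //.
    by rewrite dvdM (negPf UB) orbF.
  case/dvdzP => c1 Dc; rewrite Dc expnSr PoszM dvdz_mul // (IH c1 W) //.
  apply: (mulfI l0); rewrite -Ec Dc intrM; ring.
(* Extracting powers of l must stop: some nonzero integer c is a multiple of P(xi) in Z[xi], so
   otherwise l^|c| would divide c by [clD]. *)
have clC P : ev P != 0 -> exists (s : nat) B P1, [/\ U B, U P1 & ev P * ev B = l%:R ^+ s * ev P1].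
  move=> P0; apply: contrapT => nex.
  have [A [c c0 EA]] := genE (ev P)^-1.
  have all s : exists B P1, U B /\ ev P * ev B = l%:R ^+ s * ev P1.
    elim: s => [|s [B [P1 [UB EB]]]]; first by exists 1, P; rewrite rmorph1 mulr1 mul1r.
    have [lP1|UP1] := boolP (l %| P1.[n])%Z; last by case: nex; exists s, B, P1.
    have [B' [P2 [UB' EB']]] := clB _ lP1.
    exists (B * B'), P2; split; first exact: UM.
    by rewrite rmorphM mulrA EB -mulrA EB' mulrA exprSr.
  have [B [P1 [UB EB]]] := all `|c|%N.
  have : ((l ^ `|c|)%N %| c)%Z.
    apply: (clD _ _ B (P1 * A) UB).
    rewrite rmorphM mulrA -EB [ev A]evE -EA; field; exact: P0.
  rewrite dvdzE /= => /dvdn_leq; rewrite absz_gt0 => /(_ c0).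
  by rewrite leqNgt ltn_expl ?prime_gt1.
pose V x (z : int) := exists B P, [/\ U B, U P & x * ev B = (l%:R : E) ^ z * ev P].
have lz0 (z : int) : (l%:R : E) ^ z != 0 by rewrite expfz_neq0.
have Vtot x : x != 0 -> exists z, V x z.
  move=> x0; have [P [c c0 EP]] := genE x.
  have cE : ev c%:P != 0 by rewrite evC fieldExt_intr_eq0.
  have [|s [B [P1 [UB UP1 EB]]]] := clC P.
    by rewrite evE -EP mulf_neq0 // fieldExt_intr_eq0.
  have [s' [B' [P1' [UB' UP1' EB']]]] := clC _ cE.
  exists (s%:Z - s'%:Z), (B * P1'), (P1 * B'); split; try exact: UM.
  rewrite expfzDr // -exprnN -exprnP !rmorphM /=.
  have ls n' : (l%:R : E) ^+ n' != 0 by rewrite expf_neq0.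
  have Ex : x = l%:R ^+ s * ev P1 * ev B' / (ev B * l%:R ^+ s' * ev P1').
    apply: (mulIf cE); rewrite evC EP -evE.
    have -> : ev P = l%:R ^+ s * ev P1 / ev B by rewrite -EB mulfK ?U0.
    have -> : c%:~R = l%:R ^+ s' * ev P1' / ev B' by rewrite -EB' mulfK ?U0 // evC.
    by field; rewrite !U0 ?ls.
  by rewrite Ex; field; rewrite !U0 ?ls.
have Vfun x z z' : V x z -> V x z' -> z = z'.
  have main (t : nat) (z1 : int) : V x z1 -> V x (z1 + t) -> t = 0%N.
    case=> [B [P [UB UP EB]]] [B' [P' [UB' UP' EB']]].
    have : ((l ^ t)%N %| 1%Z)%Z.
      apply: (clD _ _ (P * B') (P' * B)); first exact: UM.
      apply: (mulfI (lz0 z1)); rewrite mulr1z mul1r !rmorphM /=.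
      transitivity (x * ev B * ev B'); first by rewrite EB; ring.
      transitivity (x * ev B' * ev B); first by ring.
      by rewrite EB' expfzDr // -exprnP; ring.
    by rewrite dvdzE /= dvdn1 => /eqP lt1; have := ltn_expl t (prime_gt1 pl); rewrite lt1 ltnS leqn0 => /eqP.
  move=> Vz Vz'; have [zz|zz] := leP z z'.
    have : z' = z + `|z' - z|%N by lia.
    by move=> Ez; move: Vz'; rewrite Ez => /(main _ _ Vz) ->; rewrite addr0.
  have : z = z' + `|z - z'|%N by lia.
  by move=> Ez; move: Vz; rewrite Ez => /(main _ _ Vz') ->; rewrite addr0.
have VM x y z z' : V x z -> V y z' -> V (x * y) (z + z').
  move=> [B [P [UB UP EB]]] [B' [P' [UB' UP' EB']]].
  exists (B * B'), (P * P'); split; try exact: UM.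
  by rewrite expfzDr // !rmorphM /= mulrACA EB EB' mulrACA.
have Vunit (a : int) : ~~ (l %| a)%Z -> V a%:~R 0.
  by move=> /UC Ua; exists 1, a%:P; split=> //; rewrite rmorph1 evC expr0z mulr1 mul1r.
exists l, V; split=> //; split=> //.
- by exists 1, 1; split=> //; rewrite rmorph1 expr1z.
move=> s a sa; rewrite dvdM negb_or => /andP[l2 la].
have Vs : V s 0.
  have s0 : s != 0.
    by apply: contraNneq la => s0; move: sa; rewrite s0 expr0n /= => /esym/eqP; rewrite fieldExt_intr_eq0 => /eqP ->.
  have [z Vz] := Vtot s s0; have := VM _ _ _ _ Vz Vz; rewrite -expr2 sa.
  move=> /Vfun/(_ (Vunit _ la)) z2; suff <- : z = 0 by []; clear -z2; lia.
have [B [P [UB UP]]] := Vs; rewrite expr0z mul1r => EB.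
(* [r0] is the residue of -s modulo the place; then [r0] - s is congruent to -2 s, a unit since l is
   odd. *)
have [r0 lr0] : exists r0 : int, (l %| r0 * B.[n] + P.[n])%Z.
  have cop : coprimez l B.[n].
    by rewrite coprimezE prime_coprime // -dvdzE.
  have /coprimezP [[u v] /= uv] := cop.
  exists (- (v * P.[n])).
  have -> : - (v * P.[n]) * B.[n] + P.[n] = P.[n] * u * l%:Z.
    by rewrite -{2}[P.[n]]mulr1 -uv; ring.
  exact: dvdz_mull.
have lsub r : (l %| r * B.[n] + P.[n])%Z -> V (r%:~R - s) 0.
  move=> lr; exists B, (r%:P * B - P); split=> //.
    rewrite /U hornerD hornerN hornerM hornerC.
    have -> : r * B.[n] - P.[n] = (r * B.[n] + P.[n]) - 2 * P.[n] by ring.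
    by rewrite rpredBl // dvdM negb_or l2.
  by rewrite expr0z mul1r rmorphB rmorphM /= evC -EB; ring.
have [B1 [P1 [UB1 EB1]]] : exists B1 P1, U B1 /\ ev (r0%:P * B + P) * ev B1 = l%:R * ev P1.
  by apply: clB; rewrite !hornerE.
have Er : (r0%:~R + s) * ev (B * B1) = l%:R * ev P1.
  by rewrite -EB1 rmorphD !rmorphM /= evC -EB; ring.
have [lP1|UP1] := boolP (l %| P1.[n])%Z; last first.
  exists r0; split; last exact: lsub.
  by exists (B * B1), P1; rewrite expr1z; split=> //; exact: UM.
(* Here [r0] + s lies in the square of the maximal ideal, so adding l gives valuation exactly 1. *)
exists (r0 + l%:Z); split; last first.
  by apply: lsub; rewrite mulrDl addrAC rpredD // dvdz_mulr.
exists (B * B1), (P1 + B * B1); split; first exact: UM.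
  by rewrite /U hornerD rpredDl //; exact: UM.
rewrite expr1z rmorphD /= [RHS]mulrDr -Er intrD; ring.
Qed.

(** If 0 had a valuation z, multiplying by l would make it z + 1 as well. *)
Lemma place_neq0 (E : fieldExtType rat) l (V : E -> int -> Prop) x z :
  place l V -> V x z -> x != 0.
Proof.
move=> pV Vx; apply/eqP => x0; rewrite x0 in Vx.
have := place_mul pV Vx (place_uniformizer pV); rewrite mul0r.
move/(place_fun pV Vx) => zz; have : z < z + 1 by rewrite ltrDl.
by rewrite -zz ltxx.
Qed.

Lemma place_exp (E : fieldExtType rat) l (V : E -> int -> Prop) x z n :
  place l V -> V x z -> V (x ^+ n) (z *+ n).
Proof.
move=> pV Vx; elim: n => [|n IH].
  apply: (place_unit pV (a := 1)); rewrite dvdzE /= dvdn1.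
  by case: eqP (place_prime pV) => // ->.
by rewrite exprS mulrS; apply: (place_mul pV).
Qed.

(* The constant coefficient of a monic factor of degree s of X^d - alpha is
   +- zeta^J w^s, so that w^s lies in F and its d-th power is alpha^s. *)
Lemma dvdp_Xn_sub_const (F K : fieldType) (e : {rmorphism F -> K}) (d : nat)
    (zeta alpha : F) (w : K) (G : {poly F}) :
  d.-primitive_root zeta -> alpha != 0 ->
  (forall (beta : F) s, (0 < s < d)%N -> beta ^+ d != alpha ^+ s) ->
  w ^+ d = e alpha -> G != 0 -> root (map_poly e G) w -> 'X^d - alpha%:P %| G.
Proof.
move=> pz a0 nroot wd G0 Gw; have d0 := prim_order_gt0 pz.
set f := 'X^d - alpha%:P; pose h := gcdp G f.
have f0 : f != 0 by rewrite -size_poly_eq0 size_XnsubC.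
have fw : root (map_poly e f) w.
  by rewrite rmorphB /= map_polyXn map_polyC rootE !hornerE wd subrr.
have hw : root (map_poly e h) w by rewrite gcdp_map root_gcd Gw.
have hf : h %| f := dvdp_gcdr _ _.
have h0 : h != 0 by rewrite gcdp_eq0 negb_and G0.
suff sh : size h = size f.
  have /eqp_dvdl <- : h %= f by rewrite -dvdp_size_eqp // sh.
  exact: dvdp_gcdl.
have w0 : w != 0.
  apply: contraNneq a0 => w0; move: wd; rewrite w0 expr0n -(fmorph_eq0 e).
  by case: d d0 {pz nroot f f0 fw hw hf h h0} => // n _ <-.
pose rs := [seq e zeta ^+ j * w | j <- iota 0 d].
have pez : d.-primitive_root (e zeta) by rewrite fmorph_primitive_root.
have Ef : map_poly e f = \prod_(z <- rs) ('X - z%:P).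
  have := @all_roots_prod_XsubC _ (map_poly e f) rs.
  have -> : lead_coef (map_poly e f) = 1.
    by rewrite lead_coef_map lead_coefXnsubC // rmorph1.
  rewrite scale1r; apply.
  - by rewrite size_map_poly size_XnsubC // size_map size_iota.
  - apply/allP => _ /mapP [j _ ->].
    rewrite rmorphB /= map_polyXn map_polyC rootE !hornerE exprMn wd.
    by rewrite exprAC (prim_expr_order pez) expr1n mul1r subrr.
  - rewrite uniq_rootsE map_inj_in_uniq ?iota_uniq // => i j.
    rewrite !mem_iota !add0n => /andP[_ id] /andP[_ jd] /(mulIf w0) /eqP.
    by rewrite (eq_prim_root_expr pez) /= !modn_small // => /eqP.
have : map_poly e h %| \prod_(z <- rs) ('X - z%:P) by rewrite -Ef dvdp_map.
case/dvdp_prod_XsubC => m; set rs' := mask m rs => hE.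
have sub z : z \in rs' -> exists j, z = e zeta ^+ j * w.
  by move/mem_mask => /mapP [j _ ->]; exists j.
have sizeh : size h = (size rs').+1.
  by rewrite -(size_map_poly e) (eqp_size hE) size_prod_XsubC.
have prodE : exists J, \prod_(z <- rs') z = e zeta ^+ J * w ^+ size rs'.
  elim: rs' sub {hE sizeh} => [|z r IH] sub; first by exists 0%N; rewrite big_nil mulr1.
  have [J EJ] := IH (fun y yr => sub y (@mem_behead _ (z :: r) y yr)).
  have [j Ej] := sub z (mem_head _ _).
  by exists (j + J)%N; rewrite big_cons Ej EJ /= exprD exprS mulrACA.
have h1 : (1 < size h)%N by rewrite -(size_map_poly e) (root_size_gt1 _ hw) ?map_poly_eq0.
apply/eqP; rewrite eqn_leq dvdp_leq //= leqNgt; apply/negP => sizelt.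
have rsd : (0 < size rs' < d)%N by move: h1 sizelt; rewrite size_XnsubC // sizeh; lia.
have [J EJ] := prodE.
have hc : e h.[0] = e (lead_coef h) * ((-1) ^+ size rs' * (e zeta ^+ J * w ^+ size rs')).
  have /eqpP [[u v] /= /andP[u0 v0] huv] := hE.
  have lE := congr1 lead_coef huv.
  rewrite !lead_coefZ lead_coef_map lead_coef_prod_XsubC mulr1 in lE.
  apply: (mulfI u0); rewrite mulrA lE -horner_map rmorph0 -hornerZ huv hornerZ.
  congr (_ * _); rewrite -EJ horner_prod.
  elim: (rs') => [|z r IH]; first by rewrite !big_nil mulr1.
  by rewrite !big_cons IH exprS !hornerE /=; ring.
(* This element of F maps to w^s, with s the degree of [h]: the leading coefficient, the sign and
   the power of [zeta] are removed from the constant coefficient. *)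
have := nroot (h.[0] / lead_coef h * (-1) ^+ size rs' / zeta ^+ J) _ rsd.
case/negP; apply/eqP; apply: (fmorph_inj e).
have z0 : e zeta != 0 by rewrite (prim_root_eq0 pez) -lt0n.
have l0 : e (lead_coef h) != 0 by rewrite fmorph_eq0 lead_coef_eq0.
rewrite !(rmorphXn, rmorphM, fmorphV) /= -wd -exprAC; congr (_ ^+ _).
rewrite hc rmorphN1.
rewrite [X in X / _](_ : _ = e zeta ^+ J * w ^+ size rs' * ((-1) ^+ size rs' * (-1) ^+ size rs')); last first.
  by field.
by rewrite -expr2 sqrr_sign mulr1 mulrAC mulfV ?mul1r ?expf_neq0.
Qed.

(** Otherwise n times the valuation of y would equal m, which lies strictly between 0 and n. *)
Lemma place_exp_neq (E : fieldExtType rat) l (V : E -> int -> Prop) x :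
  place l V -> V x 1 -> forall y m n, (0 < m < n)%N -> y ^+ n != x ^+ m.
Proof.
move=> pV Vx y m n mn; apply/eqP => yx.
have x0 := place_neq0 pV Vx.
have y0 : y != 0.
  apply: contraTneq mn => y0; move/eqP: yx; rewrite y0 expr0n.
  by case: n => [|n]; rewrite ?ltn0 ?andbF //= eq_sym expf_eq0 (negPf x0) andbF.
have [z Vy] := place_total pV y0.
have := place_exp m pV Vx; rewrite -yx => /(place_fun pV (place_exp n pV Vy)).
rewrite -[z *+ n]mulr_natr !natz => zn.
by have [z0|z0] := lerP z 0; move: mn zn z0; clear; nia.
Qed.

(** If G over E vanishes at w, where w^d = alpha, then X^d - alpha divides G over E(s). The
    conjugation s |-> -s inverts alpha, so X^d - 1/alpha divides the image of G too. These are
    coprime, so G has degree at least 2d. T is kept as a quotient of integers because its image is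
    then the same under every embedding. *)
Lemma irreducible_reciprocal (E : fieldExtType rat) (K : closedFieldType)
    (e : {rmorphism E -> K}) (d : nat) (zeta : E) :
  d.-primitive_root zeta ->
  exists m n : int, let T := m%:~R / n%:~R : E in
    T * (T ^+ 2 - 4) != 0 /\ irreducible_poly ('X^(2 * d) - T *: 'X^d + 1).
Proof.
move=> pz; have d0 := prim_order_gt0 pz.
(* The prime [l1] has valuation 1 at this place, hence is not a square in E. *)
have [l1 [V1 [_ pV1]]] := exists_place E (ltn0Sn 0).
have l1_gt0 := prime_gt0 (place_prime pV1).
have nsq (s : E) : s ^+ 2 != l1%:R.
  by rewrite -[l1%:R]expr1; apply: (place_exp_neq pV1 (place_uniformizer pV1)).
have irrX2 : irreducible_poly ('X^2 - (l1%:R : E)%:P).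
  apply: cubic_irreducible; first by rewrite size_XnsubC.
  by move=> s; rewrite rootE !hornerE subr_eq0 nsq.
have [E2 [inE [s [rs ext]]]] := root_extension irrX2.
have s2 : s ^+ 2 = l1%:Z%:~R.
  move: rs; rewrite rmorphB /= map_polyXn map_polyC rootE !hornerE subr_eq0 => /eqP ->.
  exact: (rmorph_nat inE l1).
have [l [V [l2 pV]]] := exists_place E2 (N := (2 * l1)%N) ltac:(by rewrite muln_gt0).
have [|r [Vp Vm]] := place_sqrt pV s2; first by [].
pose a : int := l1%:Z.
have p0 := place_neq0 pV Vp; have m0 := place_neq0 pV Vm.
pose alpha := (r%:~R + s) / (r%:~R - s).
have al0 : alpha != 0 by rewrite mulf_neq0 ?invr_neq0.
have Val : V alpha 1.
  have [z Vz] := place_total pV al0.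
  have := place_mul pV Vz Vm; rewrite divfK // => /(place_fun pV)/(_ Vp).
  by rewrite addr0 => <-.
have al4 : alpha ^+ 4 != 1.
  apply/eqP => al4; have := place_exp 4 pV Val; rewrite al4 -[1](expr0 alpha).
  by move/(place_fun pV (place_exp 0 pV Val)).
have ra : (r ^+ 2 - a)%:~R != 0 :> E2.
  have -> : (r ^+ 2 - a)%:~R = (r%:~R + s) * (r%:~R - s) :> E2.
    by rewrite rmorphB rmorphXn /= -s2; ring.
  by rewrite mulf_neq0.
(* Numerator (r + s)^2 + (r - s)^2 and denominator (r + s)(r - s) of alpha + 1/alpha. *)
pose m := 2 * (r ^+ 2 + a); pose n := r ^+ 2 - a.
exists m, n; set T : E := m%:~R / n%:~R.
have TE : inE T = alpha + alpha^-1.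
  rewrite fmorph_div !rmorph_int /alpha.
  apply: (mulIf ra); rewrite divfK //.
  rewrite /m /n rmorphM !rmorphD rmorphN rmorphXn /= -s2.
  by field; rewrite p0 m0.
split.
  rewrite -(fmorph_eq0 inE) rmorphM rmorphB rmorphXn TE rmorph_nat.
  have -> : (alpha + alpha^-1) * ((alpha + alpha^-1) ^+ 2 - 4) = (alpha ^+ 4 - 1) * (alpha ^+ 2 - 1) / alpha ^+ 3.
    by field.
  rewrite !mulf_neq0 ?invr_neq0 ?expf_neq0 // subr_eq0 //.
  by apply: contraNneq al4 => al2; rewrite (exprM _ 2 2) al2 expr1n.
set f := _ + 1.
have sf : size f = (2 * d).+1.
  rewrite /f -addrA size_polyDl size_polyXn // (leq_ltn_trans (size_polyD _ _)) //.
  rewrite gtn_max size_polyN size_poly1 (leq_ltn_trans (size_scale_leq _ _)) ?size_polyXn; lia.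
have f0 : f != 0 by rewrite -size_poly_eq0 sf.
have [sg sg2] := solve_monicpoly (fun i => if i == 0%N then e l1%:R else 0) (ltn0Sn 1).
rewrite !big_ord_recl big_ord0 /= mul0r !addr0 mulr1 in sg2.
(* [ep] and [em] are the two extensions of [e] to E(s); they send alpha to A and to 1/A. *)
have [ep [epE eps]] : exists e' : {rmorphism E2 -> K}, (forall x, e' (inE x) = e x) /\ e' s = sg.
  by apply: ext; rewrite rmorphB /= map_polyXn map_polyC rootE !hornerE sg2 subrr.
have [em [emE ems]] : exists e' : {rmorphism E2 -> K}, (forall x, e' (inE x) = e x) /\ e' s = - sg.
  by apply: ext; rewrite rmorphB /= map_polyXn map_polyC rootE !hornerE sqrrN sg2 subrr.
set A := ep alpha.
have A0 : A != 0 by rewrite fmorph_eq0.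
have emA : em alpha = A^-1.
  by rewrite /A /alpha !fmorph_div !rmorphD !rmorphN !rmorph_int eps ems opprK invf_div.
have [w wd] := solve_monicpoly (fun i => if i == 0%N then A else 0) d0.
have {}wd : w ^+ d = A.
  by rewrite wd -[in LHS](prednK d0) big_ord_recl /= mulr1 big1 ?addr0 // => i _; rewrite mul0r.
have fw : root (map_poly e f) w.
  have -> : map_poly e f = map_poly ep (map_poly inE f).
    by rewrite -map_poly_comp; apply: eq_map_poly => x /=; rewrite epE.
  rewrite /f !rmorphD !rmorphN /= !map_polyZ /= !map_polyXn !rmorph1 TE rootE !hornerE.
  rewrite mulnC exprM wd rmorphD fmorphV -/A; apply/eqP; field; exact: A0.
have pz2 : d.-primitive_root (inE zeta) by rewrite fmorph_primitive_root.
have big (G : {poly E}) : G != 0 -> root (map_poly e G) w -> (2 * d < size G)%N.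
  move=> G0 Gw.
  have EG (e' : {rmorphism E2 -> K}) : (forall x, e' (inE x) = e x) -> map_poly e G = map_poly e' (map_poly inE G).
    by move=> h; rewrite -map_poly_comp; apply: eq_map_poly => x /=; rewrite h.
  have dv : 'X^d - alpha%:P %| map_poly inE G.
    apply: (dvdp_Xn_sub_const (e := ep) (w := w) pz2) => //.
    - by move=> beta i id; apply: (place_exp_neq pV Val).
    - by rewrite map_poly_eq0.
    - by rewrite -EG.
  have mapX (e' : {rmorphism E2 -> K}) : map_poly e' ('X^d - alpha%:P) = 'X^d - (e' alpha)%:P.
    by rewrite rmorphB /= map_polyXn map_polyC.
  have d1 : 'X^d - A%:P %| map_poly e G by rewrite (EG ep) // -mapX dvdp_map.
  have d2 : 'X^d - A^-1%:P %| map_poly e G by rewrite (EG em) // -emA -mapX dvdp_map.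
  have AA : A^-1 - A != 0.
    rewrite subr_eq0; apply: contraNneq al4 => AA; rewrite -(inj_eq (fmorph_inj ep)) rmorphXn rmorph1 -/A.
    by have A2 : A ^+ 2 = 1; [rewrite expr2 -{1}AA mulVf|rewrite (exprM _ 2 2) A2 expr1n].
  have cop : coprimep ('X^d - A%:P) ('X^d - A^-1%:P).
    apply/Bezout_eq1_coprimepP; exists ((A^-1 - A)^-1%:P, - (A^-1 - A)^-1%:P) => /=.
    rewrite mulNr -mulrBr (_ : _ - _ - _ = (A^-1 - A)%:P); first by rewrite -polyCM mulVf.
    by rewrite polyCB; ring.
  have : ('X^d - A%:P) * ('X^d - A^-1%:P) %| map_poly e G by rewrite Gauss_dvdp // d1.
  move/dvdp_leq; rewrite map_poly_eq0 size_map_poly => /(_ G0).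
  have X0 B : 'X^d - B%:P != 0 :> {poly K} by rewrite -size_poly_eq0 size_XnsubC.
  by rewrite size_mul ?X0 // !size_XnsubC // addSn addnS /= mul2n addnn.
split; first by rewrite sf ltnS muln_gt0.
move=> q q1 /dvdpP [p fE].
have q0 : q != 0 by apply: contraNneq f0 => q0; rewrite fE q0 mulr0.
have pp0 : p != 0 by apply: contraNneq f0 => q0'; rewrite fE q0' mul0r.
rewrite -dvdp_size_eqp; last by rewrite fE dvdp_mull.
have sz : size f = (size p + size q).-1 by rewrite fE size_mul.
rewrite fE rmorphM rootM in fw; case/orP: fw => /big.
  move/(_ pp0) => sp; move: sz sf q1 q0; rewrite -size_poly_eq0 => sz sf q1 q0.
  exfalso; move: sp sz sf q1 q0; rewrite /=; move: (size p) (size q) (size f) => a1 b1 c1; clear; lia.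
move/(_ q0) => sq; move: sz sf pp0; rewrite -size_poly_eq0 => sz sf p0'.
move: sq sz sf p0'; move: (size p) (size q) (size f) => a1 b1 c1; clear; lia.
Qed.

Local Open Scope classical_set_scope.

(** * Intermediate fields and degrees of elements *)

Lemma intermediate_fieldP (k L : fieldType) (iota : {rmorphism k -> L}) (M : set L) :
  intermediate_field iota M <->
  [/\ M 1, forall x y, M x -> M y -> M (x - y),
      forall x y, M x -> M y -> M (x / y) & forall a, M (iota a)].
Proof.
split=> [[[M1 MB MV] Mi]|[M1 MB MV Mi]].
  split=> [|x y Mx My|x y Mx My|a].
  - exact/set_mem.
  - by apply/set_mem/MB; apply/mem_set.
  - by apply/set_mem/MV; apply/mem_set.
  - by apply: Mi; exists a.
split; last by move=> _ [a _ <-].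
split; first exact/mem_set.
- by move=> x y /set_mem Mx /set_mem My; apply/mem_set/MB.
- by move=> x y /set_mem Mx /set_mem My; apply/mem_set/MV.
Qed.

Lemma adjoin_field (k L : fieldType) (iota : {rmorphism k -> L}) (S : set L) :
  intermediate_field iota (adjoin iota S).
Proof.
apply/intermediate_fieldP; split=> [|x y Mx My|x y Mx My|a] M [fM SM];
  have /intermediate_fieldP [M1 MB MV Mi] := fM => //.
- by apply: MB; [apply: Mx|apply: My].
- by apply: MV; [apply: Mx|apply: My].
Qed.

Lemma sub_adjoin (k L : fieldType) (iota : {rmorphism k -> L}) (S : set L) :
  S `<=` adjoin iota S.
Proof. exact: sub_gen_smallest. Qed.

Lemma adjoin_sub (k L : fieldType) (iota : {rmorphism k -> L}) (S M : set L) :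
  intermediate_field iota M -> S `<=` M -> adjoin iota S `<=` M.
Proof. exact: smallest_sub. Qed.

Lemma ifield1 (k L : fieldType) (iota : {rmorphism k -> L}) (M : set L)
    (fM : intermediate_field iota M) : M 1. Proof. by have /intermediate_fieldP [] := fM. Qed.
Lemma ifieldB (k L : fieldType) (iota : {rmorphism k -> L}) (M : set L)
    (fM : intermediate_field iota M) x y : M x -> M y -> M (x - y).
Proof. by have /intermediate_fieldP [_ h _ _] := fM; apply: h. Qed.
Lemma ifield_div (k L : fieldType) (iota : {rmorphism k -> L}) (M : set L)
    (fM : intermediate_field iota M) x y : M x -> M y -> M (x / y).
Proof. by have /intermediate_fieldP [_ _ h _] := fM; apply: h. Qed.
Lemma ifieldC (k L : fieldType) (iota : {rmorphism k -> L}) (M : set L)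
    (fM : intermediate_field iota M) a : M (iota a). Proof. by have /intermediate_fieldP [] := fM. Qed.
Lemma ifield0 (k L : fieldType) (iota : {rmorphism k -> L}) (M : set L)
    (fM : intermediate_field iota M) : M 0. Proof. by rewrite -(subrr 1); apply: (ifieldB fM); apply: (ifield1 fM). Qed.
Lemma ifieldN (k L : fieldType) (iota : {rmorphism k -> L}) (M : set L)
    (fM : intermediate_field iota M) x : M x -> M (- x).
Proof. by move=> Mx; rewrite -sub0r; apply: (ifieldB fM) => //; apply: (ifield0 fM). Qed.
Lemma ifieldD (k L : fieldType) (iota : {rmorphism k -> L}) (M : set L)
    (fM : intermediate_field iota M) x y : M x -> M y -> M (x + y).
Proof. by move=> Mx My; rewrite -[y]opprK; apply: (ifieldB fM) => //; apply: (ifieldN fM). Qed.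
Lemma ifieldV (k L : fieldType) (iota : {rmorphism k -> L}) (M : set L)
    (fM : intermediate_field iota M) x : M x -> M x^-1.
Proof. by move=> Mx; rewrite -div1r; apply: (ifield_div fM) => //; apply: (ifield1 fM). Qed.
Lemma ifieldM (k L : fieldType) (iota : {rmorphism k -> L}) (M : set L)
    (fM : intermediate_field iota M) x y : M x -> M y -> M (x * y).
Proof. by move=> Mx My; rewrite -[y]invrK; apply: (ifield_div fM) => //; apply: (ifieldV fM). Qed.
Lemma ifieldX (k L : fieldType) (iota : {rmorphism k -> L}) (M : set L)
    (fM : intermediate_field iota M) x n : M x -> M (x ^+ n).
Proof.
move=> Mx; elim: n => [|n IH]; first exact: (ifield1 fM).
by rewrite exprS; apply: (ifieldM fM).
Qed.
Lemma ifield_sum (k L : fieldType) (iota : {rmorphism k -> L}) (M : set L)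
    (fM : intermediate_field iota M) (I : eqType) (r : seq I) (P : pred I) (F : I -> L) :
  (forall i, i \in r -> P i -> M (F i)) -> M (\sum_(i <- r | P i) F i).
Proof.
move=> MF; rewrite big_seq_cond; apply: (big_ind M) => [|x y|i /andP[ir Pi]].
- exact: (ifield0 fM).
- exact: (ifieldD fM).
- exact: MF.
Qed.
Lemma ifield_horner (k L : fieldType) (iota : {rmorphism k -> L}) (M : set L)
    (fM : intermediate_field iota M) (P : {poly k}) x : M x -> M (map_poly iota P).[x].
Proof.
move=> Mx; rewrite horner_coef; apply: (ifield_sum fM) => i _ _.
by rewrite coef_map; apply: (ifieldM fM); [apply: (ifieldC fM)|apply: (ifieldX fM)].
Qed.

(** As x is nonzero, factors X can be removed from an annihilator until it is q X + c with c
    nonzero; then 1/x = -q(x)/c. *)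
Lemma algebraic_inv_poly (k L : fieldType) (iota : {rmorphism k -> L}) x :
  algebraicOver iota x -> x != 0 ->
  exists q : {poly k}, x^-1 = (map_poly iota q).[x].
Proof.
move=> [p p0 px] x0; have [n] := ubnP (size p).
elim: n p p0 px => // n IH p p0 px sp.
have [q Eq] : exists q, p - p.[0]%:P = q * ('X - 0%:P).
  by apply/factor_theorem; rewrite rootE !hornerE subrr.
have {}Eq : p = q * 'X + p.[0]%:P by rewrite -[LHS](subrK p.[0]%:P) Eq subr0.
move: px; rewrite {1}Eq rmorphD rmorphM /= map_polyX map_polyC rootE !hornerE /= => /eqP qx.
have [p00|p00] := eqVneq p.[0] 0.
  apply: (IH q).
  - by apply: contraNneq p0 => q0; rewrite Eq q0 p00 mul0r addr0.
  - by move/eqP: qx; rewrite p00 rmorph0 addr0 mulf_eq0 (negPf x0) orbF.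
  - move: sp; rewrite [in size p]Eq p00 addr0 size_mulX ?ltnS //.
    by apply: contraNneq p0 => q0; rewrite Eq q0 p00 mul0r addr0.
exists (- (p.[0])^-1 *: q); rewrite map_polyZ hornerZ /= rmorphN fmorphV.
have ip : iota p.[0] != 0 by rewrite fmorph_eq0.
apply: (mulIf x0); rewrite mulVf // -mulrA.
have -> : (map_poly iota q).[x] * x = - iota p.[0] by apply/eqP; rewrite -addr_eq0 qx.
by rewrite mulNr mulrN opprK mulVf.
Qed.

(** The polynomial values at x already form a field: Q(x) is algebraic, so its inverse is a
    polynomial in Q(x). *)
Lemma adjoin1P (k L : fieldType) (iota : {rmorphism k -> L}) x y :
  algebraicOver iota x ->
  adjoin iota [set x] y <-> exists P : {poly k}, y = (map_poly iota P).[x].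
Proof.
move=> ax; split=> [|[P ->]]; last first.
  by apply: (ifield_horner (adjoin_field iota [set x])); apply: sub_adjoin.
pose M : set L := [set y | exists P : {poly k}, y = (map_poly iota P).[x]].
move=> Sy; suff: M y by [].
suff fM : intermediate_field iota M.
  by apply: (adjoin_sub fM) Sy => _ ->; exists 'X; rewrite map_polyX hornerX.
apply/intermediate_fieldP; split=> [|_ _ [P ->] [Q ->]|_ _ [P ->] [Q ->]|a].
- by exists 1; rewrite rmorph1 hornerC.
- by exists (P - Q); rewrite rmorphB !hornerE.
- have [->|Q0] := eqVneq (map_poly iota Q).[x] 0.
    by exists 0; rewrite invr0 mulr0 rmorph0 horner0.
  have [|q ->] := algebraic_inv_poly (iota := iota) (x := (map_poly iota Q).[x]) _ Q0.
    have [p p0 px] := ax; apply/integral_algebraic/integral_horner.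
      by apply/integral_poly => i; rewrite coef_map; apply: integral_id.
    exact/integral_algebraic.
  by exists (P * (q \Po Q)); rewrite rmorphM /= map_comp_poly hornerM horner_comp.
- by exists a%:P; rewrite map_polyC hornerC.
Qed.

Lemma minimal_annihilator (k L : fieldType) (iota : {rmorphism k -> L}) x :
  algebraicOver iota x ->
  exists p : {poly k}, [/\ p != 0, root (map_poly iota p) x &
    forall q : {poly k}, q != 0 -> root (map_poly iota q) x -> (size p <= size q)%N].
Proof.
move=> [p p0 px]; have [n] := ubnP (size p).
elim: n p p0 px => // n IH p p0 px sp.
have [h|] := pselect (forall q : {poly k}, q != 0 -> root (map_poly iota q) x -> (size p <= size q)%N).
  by exists p.
move/existsNP => [q /not_implyP[q0 /not_implyP[qx /negP]]]; rewrite -ltnNge => qp.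
by apply: (IH q) => //; apply: leq_trans qp _.
Qed.

Lemma horner_rVpoly_sum (k L : fieldType) (iota : {rmorphism k -> L}) x n (c : 'rV[k]_n) :
  (map_poly iota (rVpoly c)).[x] = \sum_(i < n) iota (c ord0 i) * x ^+ i.
Proof.
rewrite (horner_coef_wide _ (n := n)); last first.
  by rewrite (leq_trans (size_poly _ _)) ?size_poly.
by apply: eq_bigr => i _; rewrite coef_map coef_rVpoly_ord.
Qed.

(** The powers of x below the degree of p form a basis: remainders modulo p give coordinates, and
    two representations would differ by a smaller annihilator. *)
Lemma elt_degree_minimal (k L : fieldType) (iota : {rmorphism k -> L}) x (p : {poly k}) :
  p != 0 -> root (map_poly iota p) x ->
  (forall q : {poly k}, q != 0 -> root (map_poly iota q) x -> (size p <= size q)%N) ->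
  elt_degree iota x (size p).-1.
Proof.
move=> p0 px pmin; set n := (size p).-1.
have Dn : size p = n.+1 by rewrite prednK // lt0n size_poly_eq0.
have ax : algebraicOver iota x by exists p.
exists (fun i => x ^+ i); split=> [i|y /(adjoin1P _ ax) [P ->]].
  by apply: (ifieldX (adjoin_field iota [set x])); apply: sub_adjoin.
have hm : (map_poly iota (P %% p)).[x] = (map_poly iota P).[x].
  by rewrite [in RHS](divp_eq P p) rmorphD rmorphM !hornerE (rootP px) mulr0 add0r.
exists (poly_rV (P %% p)); split.
  by rewrite -horner_rVpoly_sum poly_rV_K ?hm // -ltnS -Dn ltn_modp p0.
move=> c; rewrite -horner_rVpoly_sum => Ec.
suff -> : P %% p = rVpoly c by rewrite rVpolyK.
apply/eqP; rewrite -subr_eq0; apply/negPn/negP => d0.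
have : (size (P %% p - rVpoly c)%R < size p)%N.
  rewrite (leq_ltn_trans (size_polyD _ _)) // gtn_max size_polyN ltn_modp p0 Dn ltnS.
  exact: size_poly.
by rewrite ltnNge pmin // rmorphB rootE !hornerE -Ec hm subrr.
Qed.

(** The n + 1 powers 1, x, ..., x^n lie in a space of dimension n; a kernel vector of their
    coordinate matrix is the polynomial. *)
Lemma annihilator_of_degree (k L : fieldType) (iota : {rmorphism k -> L}) x n :
  elt_degree iota x n ->
  exists p : {poly k}, [/\ p != 0, root (map_poly iota p) x & (size p <= n.+1)%N].
Proof.
move=> [b [_ bE]].
have /choice [c cE] (j : 'I_n.+1) : exists c : 'rV[k]_n, x ^+ j = \sum_(i < n) iota (c ord0 i) * b i.
  have [|c [cE _]] := bE (x ^+ j); last by exists c.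
  by apply: (ifieldX (adjoin_field iota [set x])); apply: sub_adjoin.
pose A := \matrix_(j < n.+1, i < n) c j ord0 i.
have : kermx A != 0.
  by rewrite kermx_eq0 /row_free neq_ltn ltnS rank_leq_col.
case/rowV0Pn => v /sub_kermxP vA v0.
exists (rVpoly v); split.
- by apply: contraNneq v0 => rv0; rewrite -[v]rVpolyK rv0 linear0.
- rewrite rootE horner_rVpoly_sum.
  under eq_bigr => j _ do rewrite cE big_distrr.
  rewrite exchange_big big1 // => i _ /=.
  under eq_bigr => j _ do rewrite mulrA -rmorphM.
  rewrite -big_distrl -rmorph_sum /=.
  have := congr1 (fun B : 'rV_n => B ord0 i) vA; rewrite !mxE => vAi.
  rewrite (eq_bigr (fun j => v ord0 j * A j i)) ?vAi ?rmorph0 ?mul0r //.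
  by move=> j _; rewrite mxE.
- exact: size_poly.
Qed.

Lemma algebraic_elt_degree (k L : fieldType) (iota : {rmorphism k -> L}) x :
  algebraicOver iota x -> exists n, elt_degree iota x n.
Proof.
by case/minimal_annihilator => p [p0 px /(elt_degree_minimal p0 px)]; exists (size p).-1.
Qed.

(** * The case d <= 2 *)

Lemma count_lt (T : eqType) (a1 a2 : pred T) (s : seq T) x :
  subpred a1 a2 -> x \in s -> a2 x -> ~~ a1 x -> (count a1 s < count a2 s)%N.
Proof.
move=> a12; elim: s => //= y s IH; rewrite inE => /orP[/eqP <- a2x /negPf -> |xs a2x a1x].
  by rewrite a2x ltnS sub_count.
have := IH xs a2x a1x; have := a12 y; case: (a1 y) => [->|_] //.
by move=> h; rewrite ltn_addl.
Qed.

(** Division uses the conjugate a' - b' u, which vanishes only if a' = b' = 0 because u is outside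
    K. *)
Lemma quadratic_field (k L : fieldType) (iota : {rmorphism k -> L}) (K : set L) u :
  intermediate_field iota K -> K (u ^+ 2) -> ~ K u ->
  intermediate_field iota [set z | exists a b, [/\ K a, K b & z = a + b * u]].
Proof.
move=> fK Ku2 nKu.
have K0 := ifield0 fK; have K1 := ifield1 fK.
have uniq0 a b : K a -> K b -> a = b * u -> b = 0.
  move=> Ka Kb ab; apply/eqP/negPn/negP => b0; apply: nKu.
  have -> : u = a / b by rewrite ab mulrAC mulfV ?mul1r.
  exact: (ifield_div fK).
apply/intermediate_fieldP; split.
- by exists 1, 0; split=> //; rewrite mul0r addr0.
- move=> _ _ [a [b [Ka Kb ->]]] [a' [b' [Ka' Kb' ->]]].
  exists (a - a'), (b - b'); split; [exact: (ifieldB fK)|exact: (ifieldB fK)|ring].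
- move=> _ _ [a [b [Ka Kb ->]]] [a' [b' [Ka' Kb' ->]]].
  have [->|z0] := eqVneq (a' + b' * u) 0.
    by exists 0, 0; rewrite invr0 mulr0 mul0r addr0.
  have zc0 : a' - b' * u != 0.
    apply: contraNneq z0 => /eqP; rewrite subr_eq0 => /eqP Ea.
    by have b0 := uniq0 _ _ Ka' Kb' Ea; rewrite Ea b0 !mul0r addr0.
  pose N := a' ^+ 2 - b' ^+ 2 * u ^+ 2.
  have EN : N = (a' + b' * u) * (a' - b' * u) by rewrite /N; ring.
  have N0 : N != 0 by rewrite EN mulf_neq0.
  have KM := ifieldM fK; have KX := ifieldX fK.
  have KN : K N by apply: (ifieldB fK); [exact: KX|apply: (KM) => //; exact: KX].
  exists ((a * a' - b * b' * u ^+ 2) / N), ((b * a' - a * b') / N); split.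
  + by apply: (ifield_div fK) => //; apply: (ifieldB fK); [exact: KM|apply: (KM) => //; exact: KM].
  + by apply: (ifield_div fK) => //; apply: (ifieldB fK); exact: KM.
  + by rewrite EN; field; rewrite z0 zc0.
- by move=> a; exists (iota a), 0; split=> //; [exact: (ifieldC fK)|rewrite mul0r addr0].
Qed.

(* If u is one of the terms outside K, then every term of K(u) lies in K or in
   K u, so the terms outside K(u) sum to 0 by induction, and the terms in K u
   sum to an element of K, hence to 0. *)
Lemma sum_square_roots_outside (k L : fieldType) (iota : {rmorphism k -> L})
    (K : set L) (s : seq L) :
  2 != 0 :> L -> intermediate_field iota K ->
  (forall x, x \in s -> K (x ^+ 2)) -> K (\sum_(x <- s) x) ->
  \sum_(x <- s | ~~ `[< K x >]) x = 0.
Proof.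
move=> two; have [n] := ubnP (count (fun x => ~~ `[< K x >]) s).
elim: n K => // n IH K sn fK sK Ksum.
have [/hasP[u us /asboolPn nKu]|/hasPn noK] := boolP (has (fun x => ~~ `[< K x >]) s); last first.
  by rewrite big_seq_cond big1 // => x /andP[/noK /negP].
have K0 := ifield0 fK; have K1 := ifield1 fK.
have fK' := quadratic_field fK (sK u us) nKu.
set K' := [set z | _] in fK'.
have KK' x : K x -> K' x by move=> Kx; exists x, 0; rewrite mul0r addr0.
have {IH}out : \sum_(x <- s | ~~ `[< K' x >]) x = 0.
  apply: IH => // [|x xs|]; [|exact/KK'/sK|exact: KK'].
  apply: (leq_trans _ (sn : (_ <= n)%N)); apply: (count_lt (x := u)) => //.
  - by move=> x; apply: contra => /asboolP/KK'/asboolP.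
  - exact/asboolPn.
  - by apply/negPn/asboolP; exists 0, 1; rewrite add0r mul1r.
pose Z := \sum_(x <- s | `[< K' x >] && ~~ `[< K x >]) x.
have EZ : \sum_(x <- s | ~~ `[< K x >]) x = Z.
  rewrite (bigID (fun x => `[< K' x >])) /= [X in _ + X](_ : _ = 0) ?addr0.
    by apply: eq_bigl => x; rewrite andbC.
  rewrite -[RHS]out; apply: eq_bigl => x; case: (asboolP (K' x)) => //=; rewrite ?andbF // andbT.
  by move=> nK'; apply/asboolPn => /KK'.
(* Both Z and Z / u lie in K, so a nonzero Z would put u in K. *)
rewrite EZ; apply/eqP/negPn/negP => Z0; apply: nKu.
have KZ : K Z.
  rewrite -EZ; have -> : \sum_(x <- s | ~~ `[< K x >]) x = \sum_(x <- s) x - \sum_(x <- s | `[< K x >]) x.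
    by rewrite [\sum_(x <- s) x](bigID (fun x => `[< K x >])) /= [RHS]addrC addKr.
  apply: (ifieldB fK) => //; apply: (ifield_sum fK) => x _; exact: asboolW.
have KZu : K (Z / u).
  rewrite mulr_suml; apply: (ifield_sum fK) => x xs /andP[/asboolP [a [b [Ka Kb Ex]]] /asboolPn nKx].
  have b0 : b != 0 by apply: contra_notN nKx => /eqP b0; rewrite Ex b0 mul0r addr0.
  have u0 : u != 0 by apply: contra_notN nKx => /eqP u0; rewrite Ex u0 mulr0 addr0.
  (* The square of a + b u contains the cross term 2 a b u, so a nonzero a would put u in K. *)
  have a0 : a = 0.
    apply/eqP/negPn/negP => a0; apply: nKx; rewrite Ex.
    apply: (ifieldD fK) => //; apply: (ifieldM fK) => //.
    have -> : u = (x ^+ 2 - (a ^+ 2 + b ^+ 2 * u ^+ 2)) / (2 * a * b).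
      by rewrite Ex; field; rewrite a0 b0 two.
    have KM := ifieldM fK; have KX := ifieldX fK.
    have K2 : K 2 by apply: (ifieldD fK).
    apply: (ifield_div fK); last by apply: (KM) => //; exact: KM.
    apply: (ifieldB fK); first exact: sK.
    apply: (ifieldD fK); first exact: KX.
    by apply: (KM); [exact: KX|exact: sK].
  by rewrite Ex a0 add0r mulfK.
have -> : u = Z / (Z / u) by rewrite invf_div mulrC divfK.
exact: (ifield_div fK).
Qed.

Definition sqrt_of_base (k L : fieldType) (iota : {rmorphism k -> L}) (x : L) : Prop :=
  exists a, x ^+ 2 = iota a.

Definition sqrt_sums (k L : fieldType) (iota : {rmorphism k -> L}) : set L :=
  [set y | exists2 s : seq L, forall x, x \in s -> sqrt_of_base iota x & y = \sum_(x <- s) x].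

(** A product of two square roots of elements of k is another one, so the sums form a ring; inverses
    are polynomials in the element by algebraicity. *)
Lemma sqrt_sums_field (k : fieldType) (L : fieldType) (iota : {rmorphism k -> L}) :
  (forall x : L, algebraicOver iota x) -> intermediate_field iota (sqrt_sums iota).
Proof.
move=> alg; set M := sqrt_sums iota.
have Msq x : sqrt_of_base iota x -> M x.
  by move=> sx; exists [:: x]; rewrite ?big_seq1 // => y; rewrite inE => /eqP ->.
have Mi a : M (iota a) by apply: Msq; exists (a ^+ 2); rewrite rmorphXn.
have MD x y : M x -> M y -> M (x + y).
  move=> [s hs ->] [s' hs' ->]; exists (s ++ s'); last by rewrite big_cat.
  by move=> z; rewrite mem_cat => /orP[/hs|/hs'].
have M0 : M 0 by rewrite -(rmorph0 iota).
have MM x y : M x -> M y -> M (x * y).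
  move=> [s hs ->] [s' hs' ->]; rewrite mulr_suml big_seq; apply: (big_ind M) => // x0 /hs [a xa].
  rewrite mulr_sumr big_seq; apply: (big_ind M) => // y0 /hs' [b yb].
  by apply: Msq; exists (a * b); rewrite exprMn xa yb rmorphM.
have MN x : M x -> M (- x) by move=> Mx; rewrite -mulN1r -(rmorphN1 iota); apply: MM.
have MX x n : M x -> M (x ^+ n).
  by move=> Mx; elim: n => [|n IH]; [rewrite expr0 -(rmorph1 iota)|rewrite exprS; apply: MM].
have MV x : M x -> M x^-1.
  have [->|x0] := eqVneq x 0; first by rewrite invr0.
  move=> Mx; have [q ->] := algebraic_inv_poly (alg x) x0.
  rewrite horner_coef; apply: (big_ind M) => // i _.
  by rewrite coef_map; apply: (MM); [exact: Mi|exact: MX].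
apply/intermediate_fieldP; split=> //.
- by rewrite -(rmorph1 iota).
- by move=> x y Mx My; apply: MD => //; apply: MN.
- by move=> x y Mx My; apply: MM => //; apply: MV.
Qed.

(** Completing the square writes x as an element of k plus a square root; elements of k are square
    roots of their own squares. *)
Lemma sqrt_sums_degree2 (k L : fieldType) (iota : {rmorphism k -> L}) (x : L) (p : {poly k}) :
  2 != 0 :> k -> p != 0 -> root (map_poly iota p) x -> (size p <= 3)%N -> sqrt_sums iota x.
Proof.
move=> two p0 px sp.
have isq a : sqrt_of_base iota (iota a) by exists (a ^+ 2); rewrite rmorphXn.
have i2 (a : k) : a != 0 -> iota a != 0 by rewrite fmorph_eq0.
have {}px : iota p`_0 + iota p`_1 * x + iota p`_2 * x ^+ 2 = 0.
  move/rootP: px; rewrite (horner_coef_wide _ (n := 3)) ?size_map_poly //.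
  by rewrite !big_ord_recl big_ord0 /= !coef_map /= !mulr1 addr0 addrA.
have [c20|c2] := eqVneq p`_2 0.
  have [c10|c1] := eqVneq p`_1 0.
    case/negP: p0; apply/eqP/polyP => -[|[|[|i]]]; rewrite coef0 //; last by rewrite nth_default // (leq_trans sp).
    apply: (fmorph_inj iota); rewrite rmorph0; move: px.
    by rewrite c20 c10 rmorph0 !mul0r !addr0.
  exists [:: iota (- p`_0 / p`_1)]; last first.
    rewrite big_seq1 rmorphM rmorphN fmorphV; apply: (mulIf (i2 _ c1)); rewrite divfK ?i2 //.
    apply/eqP; rewrite -addr_eq0 addrC [x * _]mulrC.
    by move: px; rewrite c20 rmorph0 mul0r addr0 => ->.
  by move=> z; rewrite inE => /eqP ->.
pose b := p`_1 / (2 * p`_2).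
have c22 : 2 * p`_2 != 0 by rewrite mulf_neq0.
exists [:: iota (- b); x + iota b]; last by rewrite !big_cons big_nil rmorphN addr0 addrC addrK.
move=> z; rewrite !inE => /orP[/eqP -> //|/eqP ->].
exists (b ^+ 2 - p`_0 / p`_2).
rewrite rmorphB !fmorph_div rmorphXn !fmorph_div rmorphM rmorph_nat.
have two' : 2 != 0 :> L by rewrite -(rmorph_nat iota) i2.
have -> : iota p`_0 = - (iota p`_1 * x + iota p`_2 * x ^+ 2).
  by apply/eqP; rewrite -addr_eq0 addrA px.
by field; rewrite two' i2.
Qed.

Theorem bounded_compositum_le2 (k L : fieldType) (iota : {rmorphism k -> L}) (d : nat) :
  2 != 0 :> k -> (forall x : L, algebraicOver iota x) -> (d <= 2)%N ->
  bounded_over iota (compositum_of_degree iota d).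
Proof.
move=> two alg d2; exists 2 => K fK KC _.
have two' : 2 != 0 :> L by rewrite -(rmorph_nat iota) fmorph_eq0.
have KM : K `<=` sqrt_sums iota.
  apply: subset_trans KC _; apply: adjoin_sub; first exact: sqrt_sums_field.
  move=> x /annihilator_of_degree [p [p0 px sp]].
  by apply: (sqrt_sums_degree2 two p0 px); apply: leq_trans sp _.
exists [set x | K x /\ sqrt_of_base iota x]; split.
  move=> x [_ [a xa]]; have [p [p0 px pmin]] := minimal_annihilator (alg x).
  exists (size p).-1; last exact: elt_degree_minimal.
  have /pmin : 'X^2 - a%:P != 0 by rewrite -size_poly_eq0 size_XnsubC.
  rewrite size_XnsubC // rmorphB /= map_polyXn map_polyC rootE !hornerE xa subrr eqxx.
  by move=> /(_ isT); case: (size p).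
apply/seteqP; split; last by apply: adjoin_sub => // x [].
move=> y Ky; have [s hs Ey] := KM y Ky.
have out : \sum_(x <- s | ~~ `[< K x >]) x = 0.
  apply: (sum_square_roots_outside two' fK); last by rewrite -Ey.
  by move=> x /hs [a ->]; apply: (ifieldC fK).
rewrite Ey (bigID (fun x => `[< K x >])) /= out addr0.
apply: (ifield_sum (adjoin_field _ _)) => x xs /asboolP Kx.
by apply: sub_adjoin; split=> //; apply: hs.
Qed.

(** * The case d >= 3 *)

Lemma minimal_annihilator_irreducible (k L : fieldType) (iota : {rmorphism k -> L}) x (p : {poly k}) :
  p != 0 -> root (map_poly iota p) x ->
  (forall q : {poly k}, q != 0 -> root (map_poly iota q) x -> (size p <= size q)%N) ->
  irreducible_poly p.
Proof.
move=> p0 px pmin; split.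
  by rewrite -(size_map_poly iota) (root_size_gt1 _ px) // map_poly_eq0.
move=> q q1 /dvdpP [r pE].
have r0 : r != 0 by apply: contraNneq p0 => r0; rewrite pE r0 mul0r.
have q0 : q != 0 by apply: contraNneq p0 => q0; rewrite pE q0 mulr0.
rewrite -dvdp_size_eqp; last by rewrite pE dvdp_mull.
rewrite pE size_mul //.
have := pmin q q0; have := pmin r r0; rewrite pE size_mul // => hr hq.
have : root (map_poly iota r) x || root (map_poly iota q) x by rewrite -rootM -rmorphM -pE.
move: q0 r0 q1 hr hq; rewrite -!size_poly_eq0; move: (size q) (size r) => a b.
by move=> a0 b0 a1 hr hq /orP[/hr|/hq]; move: a0 b0 a1; clear; lia.
Qed.

(** The roots of X^2d - t X^d + 1 with t = w^d + w^-d are the z^j w and the z^j / w, for z a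
    primitive d-th root of unity; the boolean selects the family. *)
Definition signed (K : fieldType) (b : bool) (w : K) : K := if b then w^-1 else w.

(* E is generated over k by an abstract root of unity [zeta] and abstract
   elements [g r]; the last clause says that these can be sent independently to
   all the candidates for their conjugates in K. *)
Lemma independent_radicals (k : fieldExtType rat) (K : closedFieldType)
    (iota : {rmorphism k -> K}) (d : nat) (zeta0 : K) (m : nat) :
  d.-primitive_root zeta0 ->
  exists (E : fieldExtType rat) (i : {rmorphism k -> E}) (zeta : E) (g : nat -> E) (w : nat -> K),
    [/\ d.-primitive_root zeta,
        forall r, (r < m)%N -> [/\ w r != 0, w r ^+ (4 * d) != 1 &
          exists t, w r ^+ d + w r ^- d = iota t] &
        forall (j : nat -> nat) (b : nat -> bool), exists e : {rmorphism E -> K},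
          [/\ forall x, e (i x) = iota x, e zeta = zeta0 &
              forall r, (r < m)%N -> e (g r) = zeta0 ^+ j r * signed (b r) (w r)]].
Proof.
move=> pz; have d0 := prim_order_gt0 pz.
elim: m => [|m [E [i [zeta [g [w [pzE hw ext]]]]]]].
  have alg : algebraicOver iota zeta0.
    exists ('X^d - 1); first by rewrite -size_poly_eq0 size_Xn_sub_1.
    by rewrite rmorphB /= map_polyXn rmorph1 rootE !hornerE prim_expr_order // subrr.
  have [p [p0 px pmin]] := minimal_annihilator alg.
  have [E [inE [zeta [_ ext]]]] := root_extension (minimal_annihilator_irreducible p0 px pmin).
  exists E, inE, zeta, (fun=> 0), (fun=> 0); split=> //.
    have [e [_ ez]] := ext K iota zeta0 px.
    by rewrite -(fmorph_primitive_root e) ez.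
  by move=> j b; have [e [eE ez]] := ext K iota zeta0 px; exists e.
have [e0 [e0E e0z _]] := ext (fun=> 0%N) (fun=> false).
have [a [c [T0 irr]]] := irreducible_reciprocal e0 pzE.
set T := a%:~R / c%:~R in T0 irr; set f := _ + 1 in irr.
have [E' [inE [g' [_ ext']]]] := root_extension irr.
pose TK : K := a%:~R / c%:~R.
(* T is rational, so the image of [f] in K, and hence the choice of roots for [g'], is the same for
   every embedding of E. *)
have eT (e : {rmorphism E -> K}) : e T = TK by rewrite fmorph_div !rmorph_int.
have root_f (e : {rmorphism E -> K}) (x : K) : x != 0 ->
    root (map_poly e f) x = (x ^+ d + x ^- d == TK).
  move=> x0; rewrite !rmorphD rmorphN /= !map_polyZ /= !map_polyXn rmorph1 rootE !hornerE eT.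
  rewrite mulnC exprM.
  have -> : (x ^+ d) ^+ 2 - TK * x ^+ d + 1 = (x ^+ d + x ^- d - TK) * x ^+ d.
    by field; rewrite expf_neq0.
  by rewrite mulf_eq0 expf_eq0 (negPf x0) andbF orbF subr_eq0.
have [W Wf] : exists W, root (map_poly e0 f) W.
  apply: closed_rootP; rewrite size_map_poly.
  by case: irr; case: (size f) => [|[]].
have W0 : W != 0.
  apply: contraTneq Wf => ->; rewrite !rmorphD rmorphN /= !map_polyZ /= !map_polyXn rmorph1 rootE !hornerE.
  by rewrite !expr0n muln_eq0 /= (gtn_eqF d0) mulr0 subrr add0r oner_eq0.
have WT : W ^+ d + W ^- d = TK by move: Wf; rewrite root_f // => /eqP.
have W4 : W ^+ (4 * d) != 1.
  move: T0; rewrite -(fmorph_eq0 e0) rmorphM rmorphB rmorphXn eT rmorph_nat -WT.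
  apply: contraNneq; rewrite mulnC exprM => W4; set A := W ^+ d in W4 *.
  have A0 : A != 0 by rewrite expf_neq0.
  have -> : (A + A^-1) * ((A + A^-1) ^+ 2 - 4) = (A ^+ 4 - 1) * (A ^+ 2 - 1) / A ^+ 3.
    by field.
  by rewrite W4 subrr !mul0r.
exists E', (inE \o i), (inE zeta), (fun r => if r == m then g' else inE (g r)),
  (fun r => if r == m then W else w r); split.
- by rewrite fmorph_primitive_root.
- move=> r; rewrite ltnS leq_eqVlt; case: eqP => [_ _|_ /= /hw //].
  by split=> //; exists (a%:~R / c%:~R); rewrite WT fmorph_div !rmorph_int.
- move=> j b; have [e [eE ez eg]] := ext j b.
  have [|e' [e'E e'g]] := ext' K e (zeta0 ^+ j m * signed (b m) W).
    have s0 : signed (b m) W != 0 by rewrite /signed; case: (b m); rewrite ?invr_eq0.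
    have z0 : zeta0 != 0 by rewrite (prim_root_eq0 pz) -lt0n.
    rewrite root_f ?mulf_neq0 ?expf_neq0 // exprMn.
    rewrite (_ : (zeta0 ^+ j m) ^+ d = 1) ?mul1r -?WT; last by rewrite -exprM mulnC exprM (prim_expr_order pz) expr1n.
    by rewrite /signed; case: (b m); rewrite // exprVn invrK addrC.
  exists e'; split=> [x|//|r] /=; rewrite ?e'E //.
  rewrite ltnS leq_eqVlt; case: eqP => [-> _ //|_ /= rm].
  by rewrite e'E eg.
Qed.

(** Dickson polynomials: D_0 = 2, D_1 = X, D_(n+2) = X D_(n+1) - D_n. Each z^j w + 1/(z^j w) is a
    root of D_d - t, of degree d. *)
Lemma dickson_poly (k L : fieldType) (iota : {rmorphism k -> L}) (n : nat) : (0 < n)%N ->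
  exists2 D : {poly k}, size D = n.+1 &
    forall x, x != 0 -> (map_poly iota D).[x + x^-1] = x ^+ n + x ^- n.
Proof.
case: n => // n _.
pose P n (D : {poly k}) :=
  forall x, x != 0 -> (map_poly iota D).[x + x^-1] = x ^+ n + x ^- n.
suff [D [D' [sD sD' _ PD']]] : exists D D' : {poly k},
    [/\ (size D <= n.+1)%N, size D' = n.+2, P n D & P n.+1 D'] by exists D'.
elim: n => [|n [D [D' [sD sD' PD PD']]]].
  exists 2%:P, 'X; rewrite size_polyC size_polyX leq_b1; split=> // x x0.
    by rewrite map_polyC hornerC /= rmorph_nat !expr0 invr1.
  by rewrite map_polyX hornerX expr1.
have sXD : size (D' * 'X) = n.+3 by rewrite size_mulX ?sD' // -size_poly_eq0 sD'.
exists D', (D' * 'X - D); split=> //; first by rewrite sD'.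
  by rewrite size_polyDl // size_polyN sXD (leq_ltn_trans sD).
move=> x x0; rewrite rmorphB rmorphM /= map_polyX !hornerE PD // PD' //.
by rewrite !exprS; field; rewrite x0 expf_neq0.
Qed.

Lemma addV_inj (L : fieldType) (x y : L) : x != 0 -> y != 0 ->
  x + x^-1 = y + y^-1 -> x = y \/ x * y = 1.
Proof.
move=> x0 y0 xy; have : (x - y) * (x * y - 1) = 0.
  have -> : (x - y) * (x * y - 1) = (x + x^-1 - (y + y^-1)) * (x * y) by field; rewrite x0 y0.
  by rewrite xy subrr mul0r.
by move/eqP; rewrite mulf_eq0 !subr_eq0 => /orP[/eqP|/eqP]; [left|right].
Qed.

(* Splitting Gamma w into its parts that are even and odd under inversion shows
   that the products (Gamma - 1/Gamma)(w - 1/w) are needed; they are recovered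
   from c (w - 1/w) with c = zeta - 1/zeta, since c^2 lies in C. *)
Lemma addV_prod_mem (k L : fieldType) (iota : {rmorphism k -> L}) (C : set L)
    (zeta : L) (w : nat -> L) (m : nat) :
  intermediate_field iota C -> 2 != 0 :> L -> zeta != 0 -> zeta ^+ 2 != 1 ->
  (0 < m)%N -> (forall r, (r < m)%N -> w r != 0) -> w 0%N ^+ 2 != -1 ->
  (forall r, (r < m)%N -> C (w r + (w r)^-1)) ->
  (forall r, (r < m)%N -> C (zeta * w r + (zeta * w r)^-1)) ->
  (forall r, (r < m)%N -> C (zeta^-1 * w r + (zeta^-1 * w r)^-1)) ->
  C (\prod_(r < m) w r + (\prod_(r < m) w r)^-1).
Proof.
move=> fC two z0 z2 m0 w0 w02 C1 Cz CzV.
have CM := ifieldM fC; have CD := ifieldD fC; have CB := ifieldB fC.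
have C_1 := ifield1 fC; have C2 : C 2 by exact: CD.
have Cdiv := ifield_div fC.
pose c := zeta - zeta^-1.
have c0 : c != 0.
  rewrite /c subr_eq0; apply: contraNneq z2 => zz.
  by rewrite expr2 {2}zz mulfV.
have Ccw r : (r < m)%N -> C (c * (w r - (w r)^-1)).
  move=> rm; have -> : c * (w r - (w r)^-1) =
      zeta * w r + (zeta * w r)^-1 - (zeta^-1 * w r + (zeta^-1 * w r)^-1).
    by rewrite /c; field; rewrite z0 w0.
  by apply: (CB); [exact: Cz|exact: CzV].
have Cc2 : C (c ^+ 2).
  (* The two twisted terms at index 0 add up to (zeta + 1/zeta)(w_0 + 1/w_0), whose second factor is
     nonzero as w_0^2 is not -1. *)
  have Cs : C (zeta + zeta^-1).
    have ww : w 0%N + (w 0%N)^-1 != 0.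
      apply: contraNneq w02 => ww; rewrite -subr_eq0 opprK.
      have -> : w 0%N ^+ 2 + 1 = (w 0%N + (w 0%N)^-1) * w 0%N by field; rewrite w0.
      by rewrite ww mul0r.
    have -> : zeta + zeta^-1 = (zeta * w 0%N + (zeta * w 0%N)^-1 +
        (zeta^-1 * w 0%N + (zeta^-1 * w 0%N)^-1)) / (w 0%N + (w 0%N)^-1).
      apply: (mulIf ww); rewrite divfK //; field; rewrite z0 w0 //.
    by apply: (Cdiv); [apply: (CD); [exact: Cz|exact: CzV]|exact: C1].
  have -> : c ^+ 2 = (zeta + zeta^-1) * (zeta + zeta^-1) - 2 * 2 by rewrite /c; field.
  by apply: (CB); exact: CM.
suff [] : C (\prod_(r < m) w r + (\prod_(r < m) w r)^-1) /\
    C (c * (\prod_(r < m) w r - (\prod_(r < m) w r)^-1)) by [].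
clear m0 w02; elim: m w0 C1 Cz CzV Ccw => [|m IH] w0 C1 Cz CzV Ccw.
  by rewrite big_ord0 invr1 subrr mulr0; split; [exact: C2|exact: (ifield0 fC)].
have lt r : (r < m)%N -> (r < m.+1)%N by apply: ltnW.
have [CG CcG] := IH (fun r rm => w0 r (lt r rm)) (fun r rm => C1 r (lt r rm))
  (fun r rm => Cz r (lt r rm)) (fun r rm => CzV r (lt r rm)) (fun r rm => Ccw r (lt r rm)).
rewrite big_ord_recr /=; set G := \prod_(_ < m) _ in CG CcG *.
have G0 : G != 0 by apply/prodf_neq0 => r _; exact/w0/lt/ltn_ord.
have wm0 := w0 m (ltnSn m); have Cwm := C1 m (ltnSn m); have Ccwm := Ccw m (ltnSn m).
set v := w m in wm0 Cwm Ccwm *; split.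
  have -> : G * v + (G * v)^-1 =
     ((G + G^-1) * (v + v^-1) + (c * (G - G^-1)) * (c * (v - v^-1)) / c ^+ 2) / 2.
    by field; rewrite two c0 G0 wm0.
  by apply: (Cdiv) => //; apply: (CD); [exact: CM|apply: (Cdiv) => //; exact: CM].
have -> : c * (G * v - (G * v)^-1) =
   ((c * (G - G^-1)) * (v + v^-1) + (G + G^-1) * (c * (v - v^-1))) / 2.
  by field; rewrite two G0 wm0.
by apply: (Cdiv) => //; apply: (CD); exact: CM.
Qed.

Lemma prod_signed (K : fieldType) (w : nat -> K) (m s : nat) : (s < m)%N ->
  w s != 0 -> \prod_(i < m) signed (i == s :> nat) (w i) = (\prod_(i < m) w i) * w s ^- 2.
Proof.
move=> sm s0; rewrite (bigD1 (Ordinal sm)) //= [in RHS](bigD1 (Ordinal sm)) //= eqxx /signed.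
rewrite (eq_bigr (fun i : 'I_m => w i)); first by field.
by move=> i /negPf; rewrite -val_eqE /= => ->.
Qed.

Lemma sum_eq_nat (m r : nat) : (r < m)%N -> (\sum_(i < m) (i == r :> nat))%N = 1%N.
Proof.
move=> rm; rewrite (bigD1 (Ordinal rm)) //= eqxx big1 // => i /negPf.
by rewrite -val_eqE /= => ->.
Qed.

Lemma exists_prim_root (L : closedFieldType) (d : nat) :
  (0 < d)%N -> d%:R != 0 :> L -> exists z : L, d.-primitive_root z.
Proof.
move=> d0 dL; pose p : {poly L} := 'X^d - 1.
have [rs pE] := closed_field_poly_normal p.
have lp : lead_coef p = 1 by rewrite lead_coefXnsubC.
have sp : size p = d.+1 by rewrite size_XnsubC.
rewrite lp scale1r in pE.
have srs : size rs = d by apply: succn_inj; rewrite -sp pE size_prod_XsubC.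
have rsp : all d.-unity_root rs.
  by apply/allP => z zr; rewrite unity_rootE -subr_eq0; move: zr; rewrite -root_prod_XsubC -pE rootE !hornerE.
have : uniq rs by rewrite -separable_prod_XsubC -pE cyclotomic.separable_Xn_sub_1.
by move=> urs; have /hasP [z _ pz] := cyclic.has_prim_root d0 rsp urs (eq_leq (esym srs)); exists z.
Qed.

Theorem unbounded_compositum (k : fieldExtType rat) (K : closedFieldType)
    (iota : {rmorphism k -> K}) (d : nat) :
  (forall x : K, algebraicOver iota x) -> (2 < d)%N ->
  ~ bounded_over iota (compositum_of_degree iota d).
Proof.
move=> alg d2 [c bnd]; have d0 : (0 < d)%N by apply: ltn_trans d2.
have charK n : (n%:R == 0 :> K) = (n == 0)%N.
  by rewrite -(rmorph_nat iota) fmorph_eq0 fieldExt_natr_eq0.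
have two : 2 != 0 :> K by rewrite charK.
have [z pz] : exists z : K, d.-primitive_root z.
  by apply: exists_prim_root; rewrite ?charK -?lt0n.
have z0 : z != 0 by rewrite (prim_root_eq0 pz) -lt0n.
(* This is where d >= 3 is essential. *)
have z2 : z ^+ 2 != 1 by rewrite -[1](expr0 z) (eq_prim_root_expr pz) mod0n modn_small.
(* Index 0 is reserved for the rotation by z^2; the other c + 1 indices give one more conjugate than
   a degree of at most c allows. *)
pose m := c.+2.
have [E [i [zE [g [w [pzE hw ext]]]]]] := independent_radicals iota m pz.
have w0 r : (r < m)%N -> w r != 0 by case/hw.
have w4 r : (r < m)%N -> w r ^+ (4 * d) != 1 by case/hw.
have z_inv : z^-1 = z ^+ d.-1.
  by apply: (mulfI z0); rewrite mulfV // -exprS (prednK d0) (prim_expr_order pz).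
have comp (q : {poly k}) (e : {rmorphism E -> K}) y : (forall x, e (i x) = iota x) ->
    e (map_poly i q).[y] = (map_poly iota q).[e y].
  move=> eE; rewrite -horner_map -map_poly_comp; congr (_.[_]).
  by apply: eq_map_poly => x /=; rewrite eE.
have deg r a : (r < m)%N -> elt_degree iota (z ^+ a * w r + (z ^+ a * w r)^-1) d.
  move=> rm; have [_ _ [t wt]] := hw r rm.
  have zw0 j : z ^+ j * w r != 0 by rewrite mulf_neq0 ?expf_neq0 ?w0.
  have [D sD DE] := dickson_poly iota d0.
  have sp : size (D - t%:P) = d.+1.
    by rewrite size_polyDl // size_polyN size_polyC sD (leq_ltn_trans (leq_b1 _)).
  have := @elt_degree_minimal _ _ iota (z ^+ a * w r + (z ^+ a * w r)^-1) (D - t%:P).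
  rewrite sp; apply.
  - by rewrite -size_poly_eq0 sp.
  - rewrite rmorphB /= map_polyC rootE !hornerE DE // exprMn -exprM mulnC exprM.
    by rewrite (prim_expr_order pz) expr1n mul1r wt subrr.
  (* An annihilator of one [th j] kills all d of them, and they are distinct because w_r^(4d) is not
     1. *)
  move=> q q0 qx; pose th j := z ^+ j * w r + (z ^+ j * w r)^-1.
  have [e1 [e1E e1z e1g]] := ext (fun=> a) (fun=> false).
  have qE : (map_poly i q).[g r + (g r)^-1] = 0.
    apply: (fmorph_inj e1); rewrite comp // rmorph0 rmorphD fmorphV e1g //.
    exact/rootP.
  have qth j : root (map_poly iota q) (th j).
    have [e [eE ez eg]] := ext (fun=> j) (fun=> false).
    have := comp q e (g r + (g r)^-1) eE; rewrite qE rmorph0 rmorphD fmorphV eg //.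
    by move=> h; apply/rootP; rewrite -h.
  have /max_poly_roots : map_poly iota q != 0 by rewrite map_poly_eq0.
  move=> /(_ [seq th j | j <- seq.iota 0 d]); rewrite size_map_poly size_map size_iota; apply.
    by apply/allP => _ /mapP [j _ ->].
  rewrite map_inj_in_uniq ?iota_uniq // => j1 j2.
  rewrite !mem_iota !add0n => /andP[_ jd1] /andP[_ jd2] /(addV_inj (zw0 _) (zw0 _)) [|zz].
    by move/(mulIf (w0 r rm))/eqP; rewrite (eq_prim_root_expr pz) /= !modn_small // => /eqP.
  case/negP: (w4 r rm); apply/eqP.
  have hz j : (z ^+ j) ^+ (2 * d) = 1.
    by rewrite -exprM mulnA mulnC exprM (prim_expr_order pz) expr1n.
  have : (z ^+ j1 * w r * (z ^+ j2 * w r)) ^+ (2 * d) = 1 by rewrite zz expr1n.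
  by rewrite !exprMn !hz !mul1r -exprD -mulnDl.
set C := compositum_of_degree iota d in bnd.
have fC : intermediate_field iota C by exact: adjoin_field.
have sub r a : (r < m)%N -> C (z ^+ a * w r + (z ^+ a * w r)^-1).
  by move=> rm; apply: sub_adjoin; apply: deg.
pose G := \prod_(r < m) w r.
have G0 : G != 0 by apply/prodf_neq0 => r _; apply: w0.
pose D := G + G^-1.
have CD : C D.
  apply: (addV_prod_mem fC two z0 z2 (ltn0Sn _) w0) => [|r rm|r rm|r rm].
  - apply: contraNneq (w4 0%N (ltn0Sn _)) => w2.
    have -> : (4 * d = 2 * (2 * d))%N by rewrite mulnA.
    by rewrite exprM w2 exprM sqrrN !expr1n.
  - by have := sub r 0%N rm; rewrite expr0 mul1r.
  - exact: (sub r 1%N rm).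
  - by have := sub r d.-1 rm; rewrite -z_inv.
pose Kf := adjoin iota [set D].
have fKf : intermediate_field iota Kf by exact: adjoin_field.
have [S [Sdeg KS]] : exists S : set K,
      (forall x, S x -> exists2 n : nat, (n <= c)%N & elt_degree iota x n) /\ Kf = adjoin iota S.
  apply: bnd => //; first by apply: adjoin_sub => // _ ->.
  exact: algebraic_elt_degree (alg D).
pose GE := \prod_(r < m) g r.
have eGE (e : {rmorphism E -> K}) (j : nat -> nat) (b : nat -> bool) :
    (forall r, (r < m)%N -> e (g r) = z ^+ j r * signed (b r) (w r)) ->
    e GE = z ^+ (\sum_(r < m) j r) * \prod_(r < m) signed (b r) (w r).
  move=> eg; rewrite rmorph_prod (eq_bigr _ (fun r _ => eg _ (ltn_ord r))).
  by rewrite big_split /= prodrXr.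
have no_flip : \prod_(r < m) signed false (w r) = G by [].
have [e0 [e0E _ e0g]] := ext (fun=> 0%N) (fun=> false).
have e0GE : e0 GE = G by rewrite (eGE _ _ _ e0g) big1 // expr0 mul1r.
have e0gr r : (r < m)%N -> e0 (g r) = w r by move=> rm; rewrite e0g // expr0 mul1r.
have flip s : (s < m)%N -> exists e : {rmorphism E -> K},
    [/\ forall x, e (i x) = iota x, e GE = G * w s ^- 2 &
        forall r, (r < m)%N -> e (g r) = signed (r == s) (w r)].
  move=> sm; have [e [eE _ eg]] := ext (fun=> 0%N) (fun r => r == s).
  exists e; split=> // [|r rm]; last by rewrite eg // expr0 mul1r.
  by rewrite (eGE _ _ _ eg) big1 // expr0 mul1r prod_signed // w0.
have [et [etE _ etg]] := ext (fun r => if r == 0%N then 2%N else 0%N) (fun=> false).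
have etGE : et GE = z ^+ 2 * G.
  rewrite (eGE _ _ _ etg) no_flip; congr (z ^+ _ * _).
  by rewrite big_ord_recl big1.
(* [A] plays the part of the fixed field of w_0 |-> z^2 w_0. Being a field, it contains k(D) once it
   contains the generators S. *)
pose A : set K := [set x | exists2 Y : E, e0 Y = x & et Y = x].
have fA : intermediate_field iota A.
  apply/intermediate_fieldP; split=> [|_ _ [X <- eX] [Y <- eY]|_ _ [X <- eX] [Y <- eY]|a].
  - by exists 1; rewrite rmorph1.
  - by exists (X - Y); rewrite !rmorphB // eX eY.
  - by exists (X / Y); rewrite !fmorph_div // eX eY.
  - by exists (i a); rewrite ?e0E ?etE.
have SA : S `<=` A.
  move=> x Sx; have [n nc /annihilator_of_degree [p [p0 px sp]]] := Sdeg x Sx.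
  have : Kf x by rewrite KS; apply: sub_adjoin.
  case/(adjoin1P _ (alg D)) => P Ex.
  pose Y := (map_poly i P).[GE + GE^-1].
  have e0Y : e0 Y = x by rewrite comp // rmorphD fmorphV e0GE Ex.
  exists Y => //.
  have pY (e : {rmorphism E -> K}) : (forall y, e (i y) = iota y) -> root (map_poly iota p) (e Y).
    move=> eE; apply/rootP; rewrite -comp //.
    suff -> : (map_poly i p).[Y] = 0 by rewrite rmorph0.
    by apply: (fmorph_inj e0); rewrite comp // e0Y rmorph0; apply/rootP.
  pose v s := (map_poly iota P).[G * w s ^- 2 + (G * w s ^- 2)^-1].
  have [s [r [s0 r0 sm [rm rs vrs]]]] : exists s r,
      [/\ (0 < s)%N, (0 < r)%N, (s < m)%N & [/\ (r < m)%N, r != s & v r = v s]].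
    apply: contrapT => inj; have := max_poly_roots (p := map_poly iota p) (rs := [seq v s | s <- seq.iota 1 c.+1]).
    rewrite map_poly_eq0 => /(_ p0); rewrite size_map_poly size_map size_iota.
    have -> : all (root (map_poly iota p)) [seq v s | s <- seq.iota 1 c.+1].
      apply/allP => _ /mapP [s + ->]; rewrite mem_iota add1n => /andP[_ sm].
      have [e [eE eG _]] := flip s sm.
      by have := pY e eE; rewrite comp // rmorphD fmorphV eG.
    have -> : uniq [seq v s | s <- seq.iota 1 c.+1].
      rewrite map_inj_in_uniq ?iota_uniq // => r s.
      rewrite !mem_iota add1n => /andP[r0 rm] /andP[s0 sm] vrs.
      by apply/eqP/negPn/negP => rs; apply: inj; exists s, r.
    move=> /(_ isT isT); rewrite ltnNge; case/negP.
    exact: leq_trans sp _.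
  (* Lift of [v] to E: injectivity of [e0] moves the coincidence there, and other embeddings can
     then be applied to it. *)
  pose Z t := (map_poly i P).[GE * g t ^- 2 + (GE * g t ^- 2)^-1].
  have ZE (e : {rmorphism E -> K}) t : (forall y, e (i y) = iota y) ->
      e (Z t) = (map_poly iota P).[e GE * e (g t) ^- 2 + (e GE * e (g t) ^- 2)^-1].
    by move=> eE; rewrite comp // rmorphD fmorphV rmorphM fmorphV rmorphXn.
  have Zrs : Z r = Z s.
    by apply: (fmorph_inj e0); rewrite !ZE // e0GE !e0gr //.
  (* The factor z^2 gained by the product is cancelled by (z w_r)^-2 in [Z r] but survives in [Z s].
     So [e'] and [e2] agree on [Z r] = [Z s], where the arguments of P come from z^2 G and from
     G. *)
  have [e' [e'E _ e'g]] := ext (fun t => (t == 0) + (t == r))%N (fun t => t == s).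
  have e'GE : e' GE = z ^+ 2 * (G * w s ^- 2).
    rewrite (eGE _ _ _ e'g) prod_signed ?w0 //; congr (z ^+ _ * _).
    by rewrite big_split /= !sum_eq_nat.
  have [e2 [e2E e2GE e2g]] := flip s sm.
  have w_s := w0 s sm; have w_r := w0 r rm.
  have e'r : e' (g r) = z * w r by rewrite e'g // eqxx (negPf rs) (gtn_eqF r0) expr1.
  have e's : e' (g s) = (w s)^-1.
    by rewrite e'g // eqxx [s == r]eq_sym (negPf rs) (gtn_eqF s0) expr0 mul1r.
  have e2r : e2 (g r) = w r by rewrite e2g // (negPf rs).
  have e2s : e2 (g s) = (w s)^-1 by rewrite e2g // eqxx.
  have same : e' (Z r) = e2 (Z r).
    rewrite !ZE // e'GE e2GE e'r e2r.
    by have -> : z ^+ 2 * (G * w s ^- 2) * (z * w r) ^- 2 = G * w s ^- 2 * w r ^- 2 by field; rewrite z0 w_s w_r.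
  rewrite Zrs !ZE // e'GE e2GE e's e2s in same.
  have E1 : z ^+ 2 * (G * w s ^- 2) * (w s)^-1 ^- 2 = z ^+ 2 * G by rewrite exprVn invrK mulrA divfK ?expf_neq0.
  have E2 : G * w s ^- 2 * (w s)^-1 ^- 2 = G by rewrite exprVn invrK divfK ?expf_neq0.
  by rewrite comp // rmorphD fmorphV etGE -E1 same E2 Ex.
have [Y Y0 Yt] : A D.
  by apply: (adjoin_sub fA SA); rewrite -KS; apply: sub_adjoin.
have YE : Y = GE + GE^-1 by apply: (fmorph_inj e0); rewrite Y0 rmorphD fmorphV e0GE.
rewrite YE rmorphD fmorphV etGE in Yt.
have z2G : z ^+ 2 * G != 0 by rewrite mulf_neq0 ?expf_neq0.
have [zG|zG] := addV_inj z2G G0 Yt.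
  by case/negP: z2; apply/eqP/(mulIf G0); rewrite mul1r.
(* In the remaining case z^2 G^2 = 1; inverting w_0 in G^(2d) = 1 gives w_0^(4d) = 1, which is
   excluded. *)
have G2d : GE ^+ (2 * d) = 1.
  apply: (fmorph_inj e0); rewrite rmorphXn e0GE rmorph1.
  have : (z ^+ 2 * G * G) ^+ d = 1 by rewrite zG expr1n.
  by rewrite -mulrA -expr2 exprMn -!exprM [X in z ^+ X]mulnC exprM (prim_expr_order pz) expr1n mul1r.
have [e [eE eG _]] := flip 0%N (ltn0Sn _).
have := congr1 e G2d; rewrite rmorphXn eG rmorph1 exprMn -e0GE -rmorphXn G2d rmorph1 mul1r.
rewrite exprVn -exprM => h; case/negP: (w4 0%N (ltn0Sn _)).
by rewrite -invr_eq1 mulnA in h *; rewrite h.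
Qed.

Unset Implicit Arguments.

Theorem theorem4 (k : fieldExtType rat) (kbar : closedFieldType)
    (iota : {rmorphism k -> kbar})
    (kbar_closure : is_algebraic_closure iota)
    (d : nat) (d_gt0 : (0 < d)%N) :
  bounded_over iota (compositum_of_degree iota d) <-> (d <= 2)%N.
Proof.
split; last by apply: bounded_compositum_le2; rewrite ?fieldExt_natr_eq0.
move=> bnd; rewrite leqNgt; apply/negP => d2.
exact: (unbounded_compositum kbar_closure d2).
Qed.
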